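(* Let $k\in\mathbb{N}$. There is a singular Borel action $\mathbb{F}_{2k+2}\curvearrowright(X,\mu)$ of the free group of rank $2k+2$ on a standard probability space $(X,\mu)$ which is $(k+1)$-chaining but not $k$-chaining and which has the following further property: for an arbitrary enumeration $(\gamma_n)_{n\ge1}$ of $\mathbb{F}_{2k+2}$, letting $\tilde\mu=\sum_{n\ge1}2^{-n}(\gamma_n)_*\mu$, the nonsingularization $\mathbb{F}_{2k+2}\curvearrowright(X,\tilde\mu)$ is essentially $(k+1)$-chaining but not essentially $k$-chaining.
   Context: $\mathbb{N}$ includes $0$. A Borel action $\Gamma\curvearrowright(X,\mu)$ of a countable group on a standard probability space is measure-class preserving (mcp) if for all Borel $A\subseteq X$ and $\gamma\in\Gamma$, $\mu(A)=0$ iff $\mu(\gamma A)=0$; it is singular if it is not mcp. For $k\in\mathbb{N}$, $A$ $k$-chains to $B$ if there are $\gamma_0=1_\Gamma,\gamma_1,\dots,\gamma_k\in\Gamma$ with $\mu(\gamma_iA\cap\gamma_{i+1}A)>0$ for each $0\le i<k$ and $\mu(\gamma_kA\cap B)>0$. The action is $k$-chaining if $A$ $k$-chains to $B$ for all (Borel) sets $A,B\subseteq X$ of positive measure. It is $k$-chaining on a measurable set $W\subseteq X$ if $A$ $k$-chains to $B$ for all (Borel) positive measure sets $A,B\subseteq W$ (the translates in the chain need not be contained in or meet $W$). It is essentially $k$-chaining if it is $k$-chaining on some measurable $W\subseteq X$ such that $\bigcup_{\gamma\in\Gamma}\gamma W$ is conull and $\{\gamma\in\Gamma:\mu(\gamma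 W\cap W)>0\}$ generates $\Gamma$. For the action on $(X,\tilde\mu)$, these notions are taken with respect to $\tilde\mu$. *)

(* Defs.v *)
From HB Require Import structures.
From mathcomp Require Import all_boot all_order all_algebra.
From mathcomp Require Import all_classical all_reals all_analysis.

Set Implicit Arguments.
Unset Strict Implicit.
Unset Printing Implicit Defensive.

Import Order.TTheory GRing.Theory Num.Theory.
Import numFieldNormedType.Exports.

(* A letter (i, false) is the generator i; (i, true) is its inverse. *)
Section FreeGroup.
Variable I : choiceType.
Implicit Types (x y : I * bool) (s t : seq (I * bool)).

Definition letterV x : I * bool := (x.1, ~~ x.2).

Definition reduced s : bool := sorted (fun x y => y != letterV x) s.

Definition rcons1 x s : seq (I * bool) :=
  if s is y :: s' then if y == letterV x then s' else x :: s else [:: x].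

Definition reduce s : seq (I * bool) := foldr rcons1 [::] s.

Definition invw s : seq (I * bool) := rev (map letterV s).

Lemma letterVK : involutive letterV.
Proof. by case=> i b; rewrite /letterV /= negbK. Qed.

Lemma rcons1_reduced x s : reduced s -> reduced (rcons1 x s).
Proof.
case: s => [//|y s] /=; case: eqVneq => [_ /path_sorted //|yx ys].
by rewrite /reduced /= yx.
Qed.

Lemma reduce_reduced s : reduced (reduce s).
Proof. by elim: s => [//|x s IH] /=; exact: rcons1_reduced. Qed.

Lemma reduce_id s : reduced s -> reduce s = s.
Proof.
elim: s => [//|x s IH] rs /=; rewrite IH; last exact: (path_sorted rs).
by case: s rs {IH} => [//|y s] /= /andP[/negbTE ->].
Qed.

Lemma rcons1K x s : reduced s -> rcons1 (letterV x) (rcons1 x s) = s.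
Proof.
case: s => [_|y s] /=; first by rewrite letterVK eqxx.
case: eqVneq => [->|_ _ /=]; last by rewrite letterVK eqxx.
by case: s => [//|z s] /= /andP[/negbTE ->].
Qed.

Lemma foldr_rcons1 s t : reduced t ->
  foldr rcons1 t s = foldr rcons1 t (reduce s).
Proof.
move=> rt; elim: s => [//|x s /= ->].
have rf u : reduced (foldr rcons1 t u).
  by elim: u => [//|y u IH] /=; exact: rcons1_reduced.
case: (reduce s) => [//|y u] /=; case: eqVneq => [->|//].
by rewrite -{1}[x]letterVK rcons1K.
Qed.

Lemma reduce_cat s t : reduce (s ++ t) = foldr rcons1 (reduce t) s.
Proof. exact: foldr_cat. Qed.

Lemma reduce_catl s t : reduce (reduce s ++ t) = reduce (s ++ t).
Proof. by rewrite !reduce_cat -foldr_rcons1 ?reduce_reduced. Qed.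

Lemma reduce_catr s t : reduce (s ++ reduce t) = reduce (s ++ t).
Proof. by rewrite !reduce_cat (reduce_id (reduce_reduced t)). Qed.

Lemma invwK : involutive invw.
Proof. by move=> s; rewrite /invw map_rev revK (mapK letterVK). Qed.

Lemma invw_reduced s : reduced s -> reduced (invw s).
Proof.
rewrite /reduced /invw rev_sorted sorted_map.
rewrite (eq_sorted (e' := fun x y => y != letterV x)) // => x y /=.
by rewrite letterVK eq_sym.
Qed.

Lemma reduce_invl s : reduce (invw s ++ s) = [::].
Proof.
elim: s => [//|x s IH]; rewrite /invw /= rev_cons cat_rcons reduce_cat /=.
by rewrite rcons1K ?reduce_reduced // -reduce_cat.
Qed.

Lemma reduce_invr s : reduce (s ++ invw s) = [::].
Proof. by rewrite -{1}[s]invwK reduce_invl. Qed.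

Record free_group := FreeGroup { word :> seq (I * bool); _ : reduced word }.

HB.instance Definition _ := [isSub for word].
HB.instance Definition _ := [Choice of free_group by <:].

Lemma word_reduced (g : free_group) : reduced g. Proof. exact: valP g. Qed.

Definition fg_one : free_group := @FreeGroup [::] isT.
Definition fg_mul (g h : free_group) := FreeGroup (reduce_reduced (g ++ h)).
Definition fg_inv (g : free_group) := FreeGroup (invw_reduced (word_reduced g)).

Lemma fg_mulA : associative fg_mul.
Proof.
by move=> f g h; apply: val_inj; rewrite /= reduce_catl reduce_catr catA.
Qed.

Lemma fg_mul1g : left_id fg_one fg_mul.
Proof. by move=> g; apply: val_inj; rewrite /= (reduce_id (word_reduced g)). Qed.

Lemma fg_mulg1 : right_id fg_one fg_mul.
Proof.
by move=> g; apply: val_inj; rewrite /= cats0 (reduce_id (word_reduced g)).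
Qed.

Lemma fg_mulVg : left_inverse fg_one fg_inv fg_mul.
Proof. by move=> g; apply: val_inj; exact: reduce_invl. Qed.

Lemma fg_mulgV : right_inverse fg_one fg_inv fg_mul.
Proof. by move=> g; apply: val_inj; exact: reduce_invr. Qed.

HB.instance Definition _ :=
  isGroup.Build free_group fg_mulA fg_mul1g fg_mulg1 fg_mulVg fg_mulgV.

Definition fg_gen (i : I) : free_group := @FreeGroup [:: (i, false)] isT.

Lemma fg_lift (G : groupType) (f : I -> G) :
  exists phi : free_group -> G,
    [/\ {morph phi : x y / (x * y)%g}, forall i, phi (fg_gen i) = f i &
        forall psi : free_group -> G, {morph psi : x y / (x * y)%g} ->
          (forall i, psi (fg_gen i) = f i) -> psi =1 phi].
Proof.
pose ev x : G := (if x.2 then (f x.1)^-1 else f x.1)%g.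
pose evs s : G := foldr (fun x z => ev x * z)%g 1%g s.
have evV x : ev (letterV x) = (ev x)^-1%g.
  by case: x => i [] //=; rewrite /ev /= invgK.
have evs1 x s : evs (rcons1 x s) = (ev x * evs s)%g.
  case: s => [//|y s] /=; case: eqVneq => [->|//].
  by rewrite evV mulVKg.
have evsM s t : evs (s ++ t) = (evs s * evs t)%g.
  by elim: s => [|x s IH] /=; rewrite ?mul1g // IH mulgA.
have evsR s : evs (reduce s) = evs s.
  by elim: s => [//|x s IH] /=; rewrite evs1 IH.
exists (fun g => evs g); split.
- by move=> g h; rewrite /= evsR evsM.
- by move=> i; rewrite /= mulg1.
move=> psi psiM psif.
have psi1 : psi 1%g = 1%g.
  by apply: (mulgI (psi 1%g)); rewrite -psiM !mulg1.
have psiV g : psi g^-1%g = (psi g)^-1%g.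
  by apply: (mulgI (psi g)); rewrite -psiM !mulgV.
case=> s rs /=; elim: s rs => [|x s IH] rs.
  by rewrite -[RHS]psi1; congr psi; exact: val_inj.
have rs' : reduced s := path_sorted rs.
pose gx : free_group := @FreeGroup [:: x] isT.
have -> : FreeGroup rs = (gx * FreeGroup rs')%g.
  apply: val_inj.
  by rewrite /= (reduce_id rs') -[LHS](reduce_id rs) /= (reduce_id rs').
rewrite psiM IH /=; congr (_ * _)%g.
case: x @gx {rs} => i [] gx; last by rewrite /ev /= -psif; congr psi; exact: val_inj.
by rewrite /ev /= -psif -psiV; congr psi; exact: val_inj.
Qed.

End FreeGroup.

Local Open Scope classical_set_scope.
Local Open Scope ring_scope.

Definition generates (G : groupType) (S : set G) : Prop :=
  smallest (fun H : set G => group_closed [in H]) S = setT.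

(* X is Borel isomorphic to a Polish space T. *)
Definition standard_borel (R : realType) d (X : measurableType d) : Prop :=
  exists (T : completePseudoMetricType R) (f : X -> T),
    [/\ hausdorff_space T, @second_countable T, bijective f &
        forall A : set T, <<s open >> A <-> measurable (f @^-1` A)].

Record borel_action (G : groupType) d (X : measurableType d) := BorelAction {
  act :> G -> {mfun X >-> X};
  act1 : forall x, act 1%g x = x;
  actM : forall g h x, act (g * h)%g x = act g (act h x) }.

Section Chaining.
Local Open Scope ereal_scope.
Context (R : realType) (G : groupType) d (X : measurableType d).
Variables (a : borel_action G X) (mu : {measure set X -> \bar R}).
Implicit Types (A B W : set X) (k : nat).

Definition mcp : Prop := forall A (g : G), measurable A ->
  mu A = 0 <-> mu (a g @` A) = 0.

Definition singular : Prop := ~ mcp.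

(* Only the values g 0, ..., g k are used. *)
Definition chains k A B : Prop := exists g : nat -> G,
  [/\ g 0%N = 1%g,
      forall i, (i < k)%N -> 0 < mu ((a (g i) @` A) `&` (a (g i.+1) @` A)) &
      0 < mu ((a (g k) @` A) `&` B)].

Definition chaining_on W k : Prop := forall A B,
  measurable A -> measurable B -> A `<=` W -> B `<=` W ->
  0 < mu A -> 0 < mu B -> chains k A B.

Definition chaining k : Prop := chaining_on setT k.

Definition essentially_chaining k : Prop := exists W,
  [/\ measurable W, chaining_on W k,
      mu (~` \bigcup_g (a g @` W)) = 0 &
      generates [set g : G | 0 < mu ((a g @` W) `&` W)]].

End Chaining.

Section Nonsingularization.
Local Open Scope ereal_scope.
Context (R : realType) (G : groupType) d (X : measurableType d).
Variables (a : borel_action G X) (mu : {measure set X -> \bar R}).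

Section Translate.
Variable g : G.

Definition translate : set X -> \bar R := pushforward mu (a g).

Let mg : measurable_fun setT (a g) := measurable_funPT (a g).

Let translate0 : translate set0 = 0.
Proof. by rewrite /translate measure0. Qed.

Let translate_ge0 A : 0 <= translate A.
Proof. by rewrite /translate measure_ge0. Qed.

Let translate_sigma_additive : semi_sigma_additive translate.
Proof. exact: measure_semi_sigma_additive. Qed.

HB.instance Definition _ := isMeasure.Build _ _ _ translate
  translate0 translate_ge0 translate_sigma_additive.

End Translate.

(* The series starts at n = 1; gamma 0 is ignored. *)
Definition nonsingularization (gamma : nat -> G) : {measure set X -> \bar R} :=
  mseries (fun n => mscale (2 ^- n)%:nng%R (translate (gamma n))) 1.

End Nonsingularization.

(* Main.v *)
(* Let K = F_2((t)), O = F_2[[t]] and n = k + 1. The group acts on K^(n x n) by affine maps x |-> x q + c in which q - 1 only feeds on the last column of x, hence has rank at most one: the generators scale the last column by 1/t, add the last column to another one, or translate the last column by a unit vector. mu is the Haar measure of O^(n x n).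

If A is a cell of radius |t|^N, every translate of A is a point, plus the cell, plus matrices whose rows are multiples of one row vector f. A k-chain thus only produces, up to the cell, displacements whose rows lie in the span of k vectors f_1, ..., f_k. A polynomial vector w orthogonal to all of them, with a nonzero constant coefficient, shows that the displacement t^(N-1) 1 is never reached. As x and x + t^(N-1) 1 both lie in any given set of positive measure for many x and large N, no set of positive measure is k-chaining.

Conversely, blowing up the last column of A around a well-chosen centre by a large power of 1/t gives a set which, on many fibres, is spread like A over the whole column. It therefore meets A and A + c for any c supported on the last column; conjugating by column additions yields n directions in which one step realizes every displacement. These directions span all matrices. *)
Require Import Defs.
From HB Require Import structures.
From mathcomp Require Import all_boot all_order all_algebra.
From mathcomp Require Import all_classical all_reals all_analysis.
From mathcomp Require Import zify ring lra.

Set Implicit Arguments.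
Unset Strict Implicit.
Unset Printing Implicit Defensive.

Import Order.TTheory GRing.Theory Num.Theory.
Import numFieldNormedType.Exports.

Local Open Scope classical_set_scope.
Local Open Scope ring_scope.

(** * The coin-tossing measure *)

Section Bits.
Variable J : countType.

Definition cyl (t : seq J) (v : J -> bool) : set (J -> bool) :=
  [set x | forall j, j \in t -> x j = v j].

(** The empty set is included to make the family closed under intersection. *)
Definition cylinders : set (set (J -> bool)) :=
  [set A | A = set0 \/ exists t v, uniq t /\ A = cyl t v].

Definition bits := g_sigma_algebraType cylinders.

Lemma measurable_cyl t v : uniq t -> measurable (cyl t v : set bits).
Proof. by move=> ut; apply: sub_sigma_algebra; right; exists t, v. Qed.

Lemma measurable_bit j : measurable [set x : bits | x j].
Proof.
rewrite [X in measurable X](_ : _ = cyl [:: j] (cst true)).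
  exact: measurable_cyl.
apply/seteqP; split => x /=; first by move=> xj i; rewrite inE => /eqP ->.
by move=> /(_ j); rewrite inE eqxx => ->.
Qed.

Lemma measurable_bits d (T : measurableType d) (f : T -> bits) :
  (forall j, measurable (f @^-1` [set x | x j])) -> measurable_fun setT f.
Proof.
move=> mf; apply: (@measurability _ _ T bits setT f cylinders) => //.
move=> _ [_ [->|[t [v [ut ->]]]] <-].
  by rewrite preimage_set0 setI0; exact: measurable0.
rewrite setTI; elim: t {ut} => [|j t IH].
  by rewrite [X in measurable X](_ : _ = setT) //; apply/seteqP; split.
rewrite [X in measurable X](_ : _ =
  (if v j then f @^-1` [set x | x j] else ~` (f @^-1` [set x | x j])) `&`
  f @^-1` cyl t v).
  by apply: measurableI => //; case: (v j) => //; exact: measurableC.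
apply/seteqP; split => x /=.
- move=> h; split; last by move=> i it; apply: h; rewrite inE it orbT.
  have := h j; rewrite inE eqxx => /(_ isT).
  by case: (v j) => /= -> //.
- move=> [h1 h2] i; rewrite inE => /predU1P[-> |]; last exact: h2.
  move: h1; case: (v j) => //=.
  by move=> /negP/negbTE.
Qed.

Lemma measurable_fun_bit d (T : measurableType d) (f : T -> bits) j :
  measurable_fun setT f -> measurable [set x | f x j].
Proof.
move=> mf; rewrite -[X in measurable X]setTI.
by apply: (mf measurableT [set x : bits | x j]); exact: measurable_bit.
Qed.

Lemma measurable_bits_eq d (T : measurableType d) (f g : T -> bits) j :
  measurable_fun setT f -> measurable_fun setT g ->
  measurable [set x | f x j = g x j].
Proof.
move=> mf mg; rewrite [X in measurable X](_ : _ =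
  ([set x | f x j] `&` [set x | g x j]) `|`
  (~` [set x | f x j] `&` ~` [set x | g x j])).
  by apply: measurableU; apply: measurableI; try apply: measurableC;
    exact: measurable_fun_bit.
apply/seteqP; split => x /=.
- by move=> ->; case: (g x j); [left|right; split => /negP; apply].
- by case: (f x j); case: (g x j) => //= -[[]|[]].
Qed.

Lemma cylindersI : setI_closed cylinders.
Proof.
move=> A B; have [-> _ _|/set0P[x [Ax Bx]]] := eqVneq (A `&` B) set0; first by left.
move=> [A0|[t [v [ut Av]]]]; first by rewrite A0 in Ax.
move=> [B0|[s [w [us Bw]]]]; first by rewrite B0 in Bx.
(* Any common point x of the two cylinders supplies the values prescribed by the intersection. *)
right; exists (undup (t ++ s)), x; split; first exact: undup_uniq.
rewrite {}Av in Ax *; rewrite {}Bw in Bx *.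
apply/seteqP; split => y /=.
- move=> [yt ys] j; rewrite mem_undup mem_cat => /orP[jt|js].
    by rewrite yt // Ax.
  by rewrite ys // Bx.
- move=> h; split => j jt.
    by rewrite h ?Ax // mem_undup mem_cat jt.
  by rewrite h ?Bx // mem_undup mem_cat jt orbT.
Qed.

Lemma bits_measure_unique (R : realType) (m1 m2 : {measure set bits -> \bar R}) :
  (m1 setT < +oo)%E ->
  (forall t v, uniq t -> m1 (cyl t v) = m2 (cyl t v)) ->
  forall A, measurable A -> m1 A = m2 A.
Proof.
move=> fin e; have cylT : cyl [::] (cst true) = setT by apply/seteqP; split.
move=> A mA; refine (@measure_unique _ R bits cylinders (fun=> setT) _ _ _ _ m1 m2 _ _ A mA) => //.
- exact: cylindersI.
- by move=> i; right; exists [::], (cst true); rewrite cylT.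
- by rewrite bigcup_const.
- by move=> B [->|[t [v [ut ->]]]]; rewrite ?measure0 ?e.
Qed.

End Bits.

(** * Independence of the binary digits of a uniform number *)

Section BinaryDigits.
Variable R : realType.
Implicit Types (x : R) (m d j : nat).

Definition digit m x : bool := odd (Num.truncn (x * 2 ^+ m.+1)).

Definition dyadic m j : set R := `[j%:R / 2 ^+ m, j.+1%:R / 2 ^+ m[%classic.

Lemma dyadicE m j x : dyadic m j x <-> (0 <= x) /\ Num.truncn (x * 2 ^+ m) = j.
Proof.
have p : 0 < 2 ^+ m :> R by rewrite exprn_gt0.
rewrite /dyadic /= in_itv /= ler_pdivrMr // ltr_pdivlMr //; split.
  move=> /andP[a b].
  have x0 : 0 <= x by rewrite -(pmulr_lge0 _ p) (le_trans _ a).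
  by split => //; apply/eqP; rewrite truncn_eq ?a ?b // mulr_ge0 // ltW.
by move=> [x0 <-]; rewrite truncn_itv // mulr_ge0 // ltW.
Qed.

Lemma digit_dyadic m j x : dyadic m.+1 j x -> digit m x = odd j.
Proof. by move=> /dyadicE[_]; rewrite /digit => ->. Qed.

Lemma dyadicS m j : dyadic m j = dyadic m.+1 j.*2 `|` dyadic m.+1 j.*2.+1.
Proof.
have p : 0 < 2 ^+ m :> R by rewrite exprn_gt0.
have p' : 0 < 2 ^+ m.+1 :> R by rewrite exprn_gt0.
have e : forall i : nat, (i.*2)%:R = 2 * i%:R :> R by move=> i; rewrite -muln2 natrM mulrC.
apply/seteqP; split => x /=.
- rewrite /dyadic /= !in_itv /= !ler_pdivrMr // !ltr_pdivlMr // exprS => /andP[a b].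
  have [h|h] := ltP (x * (2 * 2 ^+ m)) (j.*2.+1)%:R; [left|right].
    by rewrite andbT e; move: a; rewrite -subr_ge0 => a; lra.
  by rewrite -doubleS e; lra.
- rewrite /dyadic /= !in_itv /= !ler_pdivrMr // !ltr_pdivlMr // exprS.
  by move=> [] /andP[]; rewrite -?doubleS -?natr1 !e => a b; apply/andP; split; lra.
Qed.

Lemma dyadicS_disj m j : dyadic m.+1 j.*2 `&` dyadic m.+1 j.*2.+1 = set0.
Proof.
apply/seteqP; split => x //= [/digit_dyadic a /digit_dyadic].
by rewrite a oddS odd_double.
Qed.

Lemma measurable_dyadic m j : measurable (dyadic m j).
Proof. exact: measurable_itv. Qed.

Lemma measurable_digit m : measurable [set x | digit m x].
Proof.
rewrite [X in measurable X](_ : _ = \bigcup_j dyadic m.+1 j.*2.+1); last first.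
  apply/seteqP; split => x /=; last first.
    by move=> [j _ /digit_dyadic ->]; rewrite oddS odd_double.
  move=> xm; exists (Num.truncn (x * 2 ^+ m.+1))./2 => //.
  apply/dyadicE; split.
    rewrite leNgt; apply/negP => x0; move: xm; rewrite /digit.
    suff -> : Num.truncn (x * 2 ^+ m.+1) = 0%N by [].
    by apply/truncn0Pn; rewrite -ltNge (@lt_trans _ _ 0) // pmulr_llt0 // exprn_gt0.
  by rewrite -[LHS]odd_double_half [odd _]xm.
by apply: bigcup_measurable => j _; exact: measurable_dyadic.
Qed.

Let P := uniform_prob (@ltr01 R).

Lemma uniform_dyadic m j : (j < 2 ^ m)%N -> P (dyadic m j) = ((2 ^+ m)^-1)%:E.
Proof.
move=> jm; have p : 0 < 2 ^+ m :> R by rewrite exprn_gt0.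
rewrite /P /uniform_prob integral_uniform_pdf.
have sub : dyadic m j `<=` `[0, 1]%classic.
  move=> x; rewrite /dyadic /= !in_itv /= => /andP[a b].
  rewrite (le_trans _ a) ?divr_ge0 ?exprn_ge0 //= (le_trans (ltW b)) //.
  by rewrite ler_pdivrMr // mul1r -natrX ler_nat.
rewrite (setIidl sub) (eq_integral (fun=> 1%:E)); last first.
  move=> x; rewrite inE => /sub; rewrite /= in_itv /= /uniform_pdf => ->.
  by rewrite subr0 invr1.
rewrite integral_cst /=; last exact: measurable_dyadic.
rewrite mul1e /dyadic lebesgue_measure_itv /= lte_fin ltr_pM2r ?invr_gt0 //.
by rewrite ltr_nat ltnSn -EFinB -mulrBl -natr1 addrAC subrr add0r mul1r.
Qed.

Definition digits_in (t : seq nat) (w : nat -> bool) m d : set R :=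
  [set x | forall i, (m <= i < m + d)%N -> i \in t -> digit i x = w i].

(** Halving the dyadic interval d times reads the next d digits. A constrained digit keeps one half;
    a free digit adds up both halves, which restores the factor 2. *)
Lemma uniform_digits_in t w d m j : (j < 2 ^ m)%N ->
  P (dyadic m j `&` digits_in t w m d) =
  ((2 ^+ (m + count [in t] (iota m d)))^-1)%:E.
Proof.
elim: d m j => [|d IH] m j jm.
  rewrite /= addn0 setIidl ?uniform_dyadic // => x _ i.
  by rewrite addn0 ltnNge; case: leqP.
have j2 (b : bool) : (b + j.*2 < 2 ^ m.+1)%N.
  rewrite expnS mul2n; apply: (@leq_ltn_trans j.*2.+1); last by rewrite ltn_Sdouble.
  by case: b; rewrite ?add1n ?add0n ?leqnn ?leqnSn.
have split_in x : digits_in t w m d.+1 x <->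
    (m \in t -> digit m x = w m) /\ digits_in t w m.+1 d x.
  split=> [h|[h1 h2] i].
    split; first by apply: h; rewrite leqnn /= addnS ltnS leq_addr.
    move=> i /andP[a b]; apply: h; rewrite (ltnW a) /=.
    by rewrite addnS -addSn.
  move=> /andP[]; rewrite leq_eqVlt => /predU1P[<- //|a b]; apply: h2.
  by rewrite a /= addSn -addnS.
have md (b : bool) : measurable (dyadic m.+1 (b + j.*2) `&` digits_in t w m.+1 d).
  apply: measurableI; first exact: measurable_dyadic.
  rewrite [X in measurable X](_ : _ = \bigcap_(i in [set i | (m.+1 <= i < m.+1 + d)%N /\ i \in t])
     (if w i then [set x | digit i x] else ~` [set x | digit i x])).
    apply: bigcap_measurableType => i _; case: (w i); try apply: measurableC;
    exact: measurable_digit.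
  apply/seteqP; split => x /= h i.
    by move=> /= [hi it]; move: (h i hi it); case: (w i) => /= -> //.
  by move=> hi it; have := h i (conj hi it); case: (w i) => //= /negP/negbTE.
pose Q (b : bool) := dyadic m.+1 (b + j.*2) `&` digits_in t w m.+1 d.
have PQ b : P (Q b) = ((2 ^+ (m.+1 + count [in t] (iota m.+1 d)))^-1)%:E.
  by rewrite /Q IH.
rewrite [iota m d.+1]/= [count _ _]/=; have [mt|mt] := boolP (m \in t).
  rewrite [X in P X](_ : _ = Q (w m)) ?PQ ?addnA ?addn1 // /Q dyadicS.
  apply/seteqP; split => x /=.
    rewrite split_in => -[h [/(_ mt) hm ?]]; split => //; move: h hm.
    by move=> [h|h]; rewrite (digit_dyadic h) /= ?oddS odd_double /= => <-.
  move=> [h ?]; rewrite split_in; split; last first.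
    by split => // _; rewrite (digit_dyadic h) oddD odd_double addbF; case: (w m).
  by case: (w m) h; [right|left].
rewrite add0n [X in P X](_ : _ = Q false `|` Q true); last first.
  rewrite /Q -setIUl dyadicS add0n add1n; apply/seteqP; split => x /= [h].
    by rewrite split_in => -[].
  by move=> ?; split=> //; rewrite split_in; split => //; rewrite (negbTE mt).
have PU : P (Q false `|` Q true) = (P (Q false) + P (Q true))%E.
  apply: measureU; [exact: md|exact: md|].
  apply/seteqP; split => x //= [[a _] [b _]]; have := dyadicS_disj m j.
  by move=> /seteqP[+ _] => /(_ x); apply; split.
rewrite PU !PQ -EFinD addSn exprS invfM -mulrDl.
have -> : 2^-1 + 2^-1 = 1 :> R by field.
by rewrite mul1r.
Qed.

End BinaryDigits.

Section Coin.
Variables (R : realType) (J : countType).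

Definition digits (x : measurableTypeR R) : bits J := fun j => digit (pickle j) x.

Lemma measurable_digits : measurable_fun setT digits.
Proof. by apply: measurable_bits => j; exact: measurable_digit. Qed.

HB.instance Definition _ := isMeasurableFun.Build _ _ _ _ digits measurable_digits.

(** The product of fair coins over J, realized as the law of the binary digits of a uniform number,
    coordinate j reading digit number [pickle j]. *)
Definition coin : probability (bits J) R :=
  distribution (uniform_prob (@ltr01 R)) digits.

Lemma coin_cyl t v : uniq t -> coin (cyl t v) = ((2 ^+ size t)^-1)%:E.
Proof.
move=> ut; pose w i := if unpickle i is Some j then v j else false.
pose t' := map pickle t; pose M := (\max_(i <- t') i).+1.
have tM i : i \in t' -> (i < M)%N.
  by move=> it; rewrite ltnS; exact: (@leq_bigmax_seq _ t' xpredT id).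
have ut' : uniq t' by rewrite map_inj_uniq //; exact: (pcan_inj pickleK).
have := @uniform_digits_in R t' w M 0 0 isT.
rewrite add0n -size_filter.
have -> : size [seq x <- iota 0 M | x \in t'] = size t.
  rewrite -(size_map pickle t); apply: perm_size; apply: uniq_perm => //.
    by rewrite filter_uniq // iota_uniq.
  move=> i; rewrite mem_filter mem_iota /= add0n.
  by case: (boolP (i \in t')) => // /tM ->.
move=> <-.
have -> : digits_in t' w 0 M = digits @^-1` cyl t v.
  apply/seteqP; split => x /= h.
    move=> j jt; rewrite /digits h ?/w ?pickleK //.
      by rewrite tM // map_f.
    by rewrite map_f.
  by move=> i _ /mapP[j jt ->]; rewrite /w pickleK -h.
have m1 := @measurable_dyadic R 0 0.
have m2 : measurable (digits @^-1` cyl t v).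
  rewrite -[X in measurable X]setTI; apply: measurable_digits => //.
  exact: measurable_cyl.
set P := uniform_prob _.
(* The digit computation covers [0,1) only; whatever lies outside is null for the uniform law. *)
have P1 : P (~` @dyadic R 0 0) = 0.
  transitivity (1 - P (@dyadic R 0 0))%E; first exact: probability_setC.
  by rewrite /P uniform_dyadic // expr0 invr1 subee.
rewrite /coin /distribution /pushforward /= -/P.
rewrite [LHS](@measureDI _ _ _ P _ _ m2 m1) setIC.
rewrite [X in (X + _)%E = _](_ : _ = 0) ?add0e //.
apply/eqP; rewrite eq_le measure_ge0 andbT -P1; apply: le_measure.
- by rewrite inE; exact: measurableD.
- by rewrite inE; exact: measurableC.
- by move=> x [].
Qed.

End Coin.
Arguments coin : simpl never.

(** * Probabilistic tools *)

Section ProductSections.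
Local Open Scope ereal_scope.
Context d1 d2 (T1 : measurableType d1) (T2 : measurableType d2) (R : realType).
Variables (P1 : probability T1 R) (P2 : probability T2 R).
Implicit Types A B : set (T1 * T2).

Lemma prod_eq A B : measurable A -> measurable B ->
  (forall x, P2 [set y | A (x, y)] = P2 [set y | B (x, y)]) ->
  (P1 \x P2) A = (P1 \x P2) B.
Proof.
move=> mA mB h; apply: eq_integral => x _ /=.
have e C : xsection C x = [set y | C (x, y)].
  by apply/seteqP; split => y; rewrite /xsection /= ?inE.
by rewrite !e.
Qed.

Lemma prod_swapE A : measurable A ->
  (P1 \x P2) A = \int[P2]_y P1 [set x | A (x, y)].
Proof.
move=> mA; rewrite (@product_measure_unique _ _ _ _ _ P1 P2 (P1 \x^ P2)%E) //; last first.
  by move=> *; exact: product_measure2E.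
apply: eq_integral => y _ /=; congr (P1 _).
by apply/seteqP; split => x; rewrite /ysection /= ?inE.
Qed.

Lemma prod_gt0_r A : measurable A -> 0 < (P1 \x P2) A ->
  exists y, 0 < P1 [set x | A (x, y)].
Proof.
move=> mA; rewrite prod_swapE // => A0; apply: contrapT => /forallNP h.
move: A0; rewrite integral0_eq ?ltxx // => y _; apply/eqP.
by rewrite eq_le measure_ge0 andbT leNgt; apply/negP/h.
Qed.

Lemma prod_eq0_ae A : measurable A -> (P1 \x P2) A = 0 ->
  P1 [set x | 0 < P2 [set y | A (x, y)]] = 0.
Proof.
move=> mA A0.
have e x : xsection A x = [set y | A (x, y)].
  by apply/seteqP; split => y; rewrite /xsection /= ?inE.
have mf := measurable_fun_xsection P2 mA.
have /(ae_eq_integral_abs _ measurableT mf).1 : \int[P1]_x `|(P2 \o xsection A) x| = 0.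
  by rewrite -[RHS]A0; apply: eq_integral => x _; rewrite gee0_abs.
move=> [N [mN N0 sN]]; apply/eqP; rewrite eq_le measure_ge0 andbT -[leRHS]N0.
apply: le_measure; rewrite ?inE //.
  rewrite [X in measurable X](_ : _ = setT `&` [set x | 0 < (P2 \o xsection A) x]).
    exact: measurable_realfun.emeasurable_fun_o_infty.
  by rewrite setTI; apply/seteqP; split => x; rewrite /= e.
move=> x /= h; apply: sN => /= h0.
by move: h; rewrite -e (h0 I) ltxx.
Qed.

End ProductSections.

(** * Coordinatewise convergence of maps with a common law *)

Section Convergence.
Local Open Scope ereal_scope.
Variables (R : realType) (J : countType).
Notation coin := (coin R J).

Definition coin_law d (T : measurableType d) (P : probability T R) (S : T -> bits J) :=
  measurable_fun setT S /\
  forall A, measurable A -> P (S @^-1` A) = coin A.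

Lemma measurable_preimage d d' (T : measurableType d) (T' : measurableType d')
  (S : T -> T') A :
  measurable_fun setT S -> measurable A -> measurable (S @^-1` A).
Proof. by move=> mS mA; rewrite -[X in measurable X]setTI; exact: mS. Qed.

Lemma coin_lawP d (T : measurableType d) (P : probability T R) (S : T -> bits J) :
  measurable_fun setT S ->
  (forall t v, uniq t -> P (S @^-1` cyl t v) = ((2 ^+ size t)^-1)%:E) ->
  coin_law P S.
Proof.
move=> mS h; split => // A mA.
pose S' : {mfun T >-> bits J} := HB.pack S (isMeasurableFun.Build _ _ _ _ S mS).
apply/esym; apply: (@bits_measure_unique J R coin (distribution P S')) => //.
  by rewrite [ltLHS](@probability_setT _ _ _ coin) ltry.
by move=> t v ut; transitivity ((2 ^+ size t)^-1 : R)%R%:E; [exact: coin_cyl|exact/esym/h].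
Qed.

Lemma coin_law_comp d (T : measurableType d) (P : probability T R) S F :
  coin_law P S -> coin_law coin F -> coin_law P (F \o S).
Proof.
move=> [mS lS] [mF lF]; split; first exact: measurableT_comp.
by move=> A mA; rewrite comp_preimage lS ?lF //; exact: measurable_preimage.
Qed.

(** The sets whose preimages under [S N] and [S'] eventually differ by little form a sigma-algebra,
    which contains the cylinders because finitely many coordinates stabilize. The common law of all
    the maps is what controls countable unions uniformly in N. *)
Lemma coin_law_cvg d (T : measurableType d) (P : probability T R)
  (S : nat -> T -> bits J) (S' : T -> bits J) :
  (forall N, coin_law P (S N)) -> coin_law P S' ->
  (forall j, exists N0, forall N, (N0 <= N)%N -> forall w, S N w j = S' w j) ->
  forall A (e : R), measurable A -> (0 < e)%R -> exists N0, forall N, (N0 <= N)%N ->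
    P (S' @^-1` A `\` S N @^-1` A) <= e%:E.
Proof.
move=> lS lS' cS A e mA e0.
pose D N (B : set (bits J)) := (S' @^-1` B `\` S N @^-1` B) `|` (S N @^-1` B `\` S' @^-1` B).
have mS' B : measurable B -> measurable (S' @^-1` B).
  by apply: measurable_preimage; case: lS'.
have mS N B : measurable B -> measurable (S N @^-1` B).
  by apply: measurable_preimage; case: (lS N).
have mD N B : measurable B -> measurable (D N B).
  move=> mB; apply: measurableU; apply: measurableD;
    by [apply: mS|apply: mS'].
pose G : set (set (bits J)) := [set B | measurable B /\ forall e : R, (0 < e)%R ->
  exists N0, forall N, (N0 <= N)%N -> P (D N B) <= e%:E].
suff GA : G A.
  have [_ /(_ e e0)[N0 hN0]] := GA; exists N0 => N /hN0; apply: le_trans.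
  apply: le_measure; rewrite ?inE; [|exact: mD|by move=> x; left].
  by apply: measurableD; [apply: mS'|apply: mS].
have G0 : G set0.
  split => // e' e'0; exists 0%N => N _; rewrite /D !preimage_set0 setD0 setU0.
  by rewrite measure0 lee_fin ltW.
have GU B C : G B -> G C -> G (B `|` C).
  move=> [mB hB] [mC hC]; split; first exact: measurableU.
  move=> e' e'0; have e2 : (0 < e' / 2)%R by rewrite divr_gt0.
  have [N1 h1] := hB _ e2; have [N2 h2] := hC _ e2.
  exists (maxn N1 N2) => N; rewrite geq_max => /andP[/h1 {}h1 /h2 {}h2].
  apply: (@le_trans _ _ (P (D N B `|` D N C))).
    apply: le_measure; rewrite ?inE; [by apply/mD/measurableU|by apply: measurableU; apply: mD|].
    move=> x [[[] h /not_orP[n1 n2]]|[[] h /not_orP[n1 n2]]];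
      by [left; left|right; left|left; right|right; right].
  apply: (le_trans (measureU2 _ _ _)); [exact: mD|exact: mD|].
  by rewrite [e']splitr EFinD leeD.
suff : <<s @cylinders J >> `<=` G by apply.
apply: smallest_sub; first split => //.
- move=> B [mB hB]; rewrite setTD; split; first exact: measurableC.
  move=> e' e'0; have [N0 hN0] := hB _ e'0; exists N0 => N /hN0.
  suff -> : D N (~` B) = D N B by [].
  apply/seteqP; split => x; rewrite /D /=.
    by move=> [[h /contrapT ?]|[h /contrapT ?]]; [right|left].
  by move=> [[h ?]|[h ?]]; [right|left]; split => //; apply.
- move=> F0; have [F -> GF] : exists F : (set (bits J))^nat, F0 = F by exists F0.
  have mF n : measurable (F n) by case: (GF n).
  have mU : measurable (\bigcup_n F n) by exact: bigcup_measurable.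
  split => // e' e'0.
  pose U K := \big[setU/set0]_(i < K) F i.
  have GUK K : G (U K).
    by rewrite /U; elim/big_ind : _ => //.
  (* The remainder [V K] left by a finite union has small coin measure, hence equally small
     preimages under [S'] and every [S N]. *)
  pose V K := \bigcup_n F n `\` U K.
  have mV K : measurable (V K) by apply: measurableD => //; case: (GUK K).
  have : coin \o V @ \oo --> coin (\bigcap_K V K).
    apply: nonincreasing_cvg_mu => //.
    - by apply: (le_lt_trans (probability_le1 _ (mV _))); exact: ltry.
    - exact: bigcap_measurableType.
    - move=> K L KL; apply/subsetPset; apply: setDS.
      exact: subset_bigsetU.
  have -> : \bigcap_K V K = set0.
    apply/seteqP; split => x // h.
    have [[n _ Fx] _] := h 0%N I.
    have [_] := h n.+1 I; apply; rewrite /U big_ord_recr /=; by right.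
  rewrite measure0 => /fine_cvgP[_ /cvgrPdist_le].
  have e4 : (0 < e' / 4)%R by rewrite divr_gt0.
  move=> /(_ _ e4)[K _ /(_ K (leqnn _))].
  rewrite [X in (`|_ - X| <= _)%R -> _](_ : _ = fine (coin (V K))) //.
  rewrite sub0r normrN ger0_norm ?fine_ge0 // -lee_fin fineK ?fin_num_measure // => VK.
  have e2 : (0 < e' / 2)%R by rewrite divr_gt0.
  have [mUK /(_ _ e2)[N0 hN0]] := GUK K.
  exists N0 => N /hN0 {}hN0.
  apply: (@le_trans _ _ (P (D N (U K) `|` (S' @^-1` V K `|` S N @^-1` V K)))).
    apply: le_measure; rewrite ?inE; [exact: mD| |].
      by apply: measurableU; [exact: mD|apply: measurableU; [exact: mS'|exact: mS]].
    move=> x [[h n]|[h n]].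
      have [hU|nU] := pselect (U K (S' x)); last by right; left; split.
      left; left; split => // hN; apply: n; move: hN; rewrite /U /= -bigcup_mkord.
      by move=> [i _ Fi]; exists i.
    have [hU|nU] := pselect (U K (S N x)); last by right; right; split.
    left; right; split => // hN; apply: n; move: hN; rewrite /U /= -bigcup_mkord.
    by move=> [i _ Fi]; exists i.
  apply: (le_trans (measureU2 _ _ _)).
  - exact: mD.
  - by apply: measurableU; [exact: mS'|exact: mS].
  rewrite [e']splitr EFinD leeD //.
  apply: (le_trans (measureU2 _ _ _)); [exact: mS'|exact: mS|].
  have -> : (e' / 2 = e' / 4 + e' / 4)%R by field.
  have [_ lS'V] := lS'; have [_ lSV] := lS N.
  have h1 : P (S' @^-1` V K) <= (e' / 4)%:E by rewrite lS'V.
  have h2 : P (S N @^-1` V K) <= (e' / 4)%:E by rewrite lSV.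
  by rewrite EFinD; exact: leeD.
- move=> B [->//|[t [v [ut ->]]]]; split; first exact: measurable_cyl.
  move=> e' e'0.
  have [N0 hN0] : exists N0, forall N, (N0 <= N)%N -> forall j, j \in t -> forall w, S N w j = S' w j.
    elim: t {ut} => [|j t [N1 h1]]; first by exists 0%N.
    have [N2 h2] := cS j; exists (maxn N1 N2) => N; rewrite geq_max => /andP[a b] i.
    by rewrite inE => /predU1P[->|]; [exact: h2|exact: h1].
  exists N0 => N /hN0 h; suff -> : D N (cyl t v) = set0 by rewrite measure0 lee_fin ltW.
  apply/seteqP; split => x //= [[a b]|[a b]]; apply: b => j jt.
    by rewrite h // a.
  by rewrite -h // a.
Qed.

End Convergence.

(** * Maps and translations preserving the coin-tossing law *)

Section CoinLaws.
Local Open Scope ereal_scope.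
Variables (R : realType) (J : countType).
Notation coin := (coin R J).

Definition coin2 : probability (bits J * bits J)%type R := coin \x coin.

(** Addition over F_2. It is also subtraction, so [A (xorf x c)] says that x lies in the translate A
    + c. *)
Definition xorf (x y : J -> bool) : bits J := fun j => x j (+) y j.

Lemma xorfC x y : xorf x y = xorf y x.
Proof. by apply/funext => j; rewrite /xorf addbC. Qed.

Lemma xorfA x y z : xorf x (xorf y z) = xorf (xorf x y) z.
Proof. by apply/funext => j; rewrite /xorf addbA. Qed.

Lemma xorfK c : involutive (xorf^~ c).
Proof. by move=> x; apply/funext => j; rewrite /xorf addbK. Qed.

Lemma measurable_xorf d (T : measurableType d) (f g : T -> bits J) :
  measurable_fun setT f -> measurable_fun setT g ->
  measurable_fun setT (fun w => xorf (f w) (g w)).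
Proof.
move=> mf mg; apply: measurable_bits => j.
rewrite [X in measurable X](_ : _ = ~` [set w | f w j = g w j]).
  by apply: measurableC; exact: measurable_bits_eq.
apply/seteqP; split => w /=; rewrite /xorf; by case: (f w j); case: (g w j).
Qed.

Lemma coin_law_xor c : coin_law coin (xorf^~ c).
Proof.
apply: coin_lawP => [|t v ut].
  by apply: measurable_xorf => //; exact: measurable_cst.
rewrite -(coin_cyl R (xorf v c) ut); congr (coin _).
apply/seteqP; split => x /= h j jt; first by rewrite /xorf -(h j jt) /xorf addbK.
by rewrite /xorf (h j jt) /xorf addbK.
Qed.

Lemma coin_xor c A : measurable A -> coin [set x | A (xorf x c)] = coin A.
Proof. by move=> mA; case: (coin_law_xor c) => _ /(_ A mA). Qed.

Definition mix (Q : pred J) (rho : J -> J) (p : bits J * bits J) : bits J :=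
  fun j => if Q j then p.2 j else p.1 (rho j).

Lemma measurable_mix Q rho : measurable_fun setT (mix Q rho).
Proof.
apply: measurable_bits => j.
suff : measurable [set p : bits J * bits J | if Q j then p.2 j else p.1 (rho j)] by [].
case: (Q j).
  exact (@measurable_fun_bit J _ (bits J * bits J)%type snd j measurable_snd).
exact (@measurable_fun_bit J _ (bits J * bits J)%type fst (rho j) measurable_fst).
Qed.

(** Injectivity of [rho] off Q makes every output coordinate read its own fair bit, so the output
    bits are again independent. *)
Lemma coin_law_mix (Q : pred J) (rho : J -> J) :
  {in predC Q &, injective rho} -> coin_law coin2 (mix Q rho).
Proof.
move=> injr; apply: coin_lawP => [|t v ut]; first exact: measurable_mix.
pose t1 := [seq j <- t | predC Q j]; pose t2 := [seq j <- t | Q j].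
have ut1 : uniq (map rho t1).
  rewrite map_inj_in_uniq ?filter_uniq // => i j.
  by rewrite !mem_filter => /andP[Qi _] /andP[Qj _]; exact: injr.
(* [u] transports the prescribed values along [rho], through the preimage found in [t1]. *)
pose u j := v (nth j t1 (index j (map rho t1))).
have uE j : j \in t1 -> u (rho j) = v j.
  move=> jt; rewrite /u; congr v; set i := index _ _.
  have it : (i < size t1)%N by rewrite -(size_map rho) index_mem map_f.
  have nt : nth (rho j) t1 i \in t1 by exact: mem_nth.
  have : rho (nth (rho j) t1 i) = rho j.
    by rewrite -(nth_map _ (rho j)) // nth_index // map_f.
  move: nt jt; rewrite !mem_filter => /andP[Qn _] /andP[Qj _].
  exact: injr.
rewrite [X in coin2 X](_ : _ = cyl (map rho t1) u `*` cyl t2 v).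
  transitivity (coin (cyl (map rho t1) u) * coin (cyl t2 v)).
    apply: product_measure1E; apply: measurable_cyl => //.
    exact: filter_uniq.
  have -> : coin (cyl (map rho t1) u) = ((2 ^+ size t1)^-1)%R%:E.
    by rewrite coin_cyl // size_map.
  have -> : coin (cyl t2 v) = ((2 ^+ size t2)^-1)%R%:E.
    by rewrite coin_cyl // filter_uniq.
  rewrite -EFinM -invfM -exprD !size_filter.
  by rewrite -[in RHS](count_predC Q t) addnC.
apply/seteqP; split => -[x y] /= h.
  split => j.
    move=> /mapP[i it ->]; rewrite uE //.
    by move: it; rewrite mem_filter => /andP[/negbTE Qi /h]; rewrite /mix Qi.
  by rewrite mem_filter => /andP[Qj /h]; rewrite /mix Qj.
move=> j jt; rewrite /mix /=; have [Qj|Qj] := boolP (Q j).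
  by apply: h.2; rewrite mem_filter Qj.
have jt1 : j \in t1 by rewrite mem_filter /= Qj.
by rewrite -(uE j jt1); apply: h.1; rewrite map_f.
Qed.

Lemma coin_law_mix_id Q : coin_law coin2 (mix Q id).
Proof. exact: coin_law_mix. Qed.

(** Once the coordinates off Q are fixed, the map translates those in Q by a constant, which
    preserves fair bits; [mix] provides this fibration. *)
Lemma coin_law_shear (Q : pred J) (f : bits J -> bits J) :
  measurable_fun setT f -> (forall x j, ~~ Q j -> f x j = false) ->
  (forall x y : bits J, (forall j, ~~ Q j -> x j = y j) -> f x = f y) ->
  coin_law coin (fun x => xorf x (f x)).
Proof.
move=> mf f0 fQ.
have msh : measurable_fun setT (fun x : bits J => xorf x (f x)) by exact: measurable_xorf.
split => // A mA; have [mm lm] := coin_law_mix_id Q.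
rewrite -lm; last exact: measurable_preimage.
rewrite -[RHS]lm //; apply: prod_eq.
- by apply: measurable_preimage => //; exact: measurable_preimage.
- exact: measurable_preimage.
move=> x; rewrite -[RHS](coin_xor (f x)).
  congr (coin _); apply/seteqP; split => y /=.
    rewrite (_ : xorf _ _ = mix Q id (x, xorf y (f x))) //.
    apply/funext => j; rewrite /xorf /mix /= (fQ (mix Q id (x, y)) x).
      by case: ifPn => // /(f0 x) ->; rewrite addbF.
    by move=> i /negbTE Qi; rewrite /mix Qi.
  rewrite (_ : xorf _ (f (mix _ _ _)) = mix Q id (x, xorf y (f x))) //.
  apply/funext => j; rewrite /xorf /mix /= (fQ (mix Q id (x, y)) x).
    by case: ifPn => // /(f0 x) ->; rewrite addbF.
  by move=> i /negbTE Qi; rewrite /mix Qi.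
rewrite [X in measurable X](_ : _ = (fun y => mix Q id (x, y)) @^-1` A) //.
by apply: measurable_preimage => //; apply: measurableT_comp.
Qed.

(** Averaging the overlap over all displacements c gives the product of the two measures, by
    translation invariance. *)
Lemma coin_overlap A B : measurable A -> measurable B ->
  0 < coin A -> 0 < coin B -> exists c, 0 < coin [set x | A x /\ B (xorf x c)].
Proof.
move=> mA mB A0 B0.
pose E := [set p : bits J * bits J | A p.1 /\ B (xorf p.1 p.2)].
have mE : measurable E.
  apply: measurableI.
    exact: (measurable_preimage (@measurable_fst _ _ (bits J) (bits J))).
  apply: (@measurable_preimage _ _ _ _ (fun p : bits J * bits J => xorf p.1 p.2)) => //.
  apply: measurable_xorf; [exact: measurable_fst|exact: measurable_snd].
apply: (prod_gt0_r mE).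
rewrite (@prod_eq _ _ _ _ _ _ _ E (A `*` B)) //.
- rewrite [X in 0 < X](_ : _ = coin A * coin B) ?mule_gt0 //.
  exact: product_measure1E.
- exact: measurableX.
move=> x; have [Ax|nAx] := pselect (A x).
  transitivity (coin B).
    rewrite -(coin_xor x mB); congr (coin _).
    by apply/seteqP; split => y; rewrite /E /= xorfC; [case|split].
  by congr (coin _); apply/seteqP; split => y //=; case.
by congr (coin _); apply/seteqP; split => y /= [].
Qed.

(** Let F consist of the points for which redrawing the coordinates in Q lands in A with positive
    probability. F ignores those coordinates, so Fubini makes A minus F null; were the conclusion
    false, A meet F would be null too. *)
Lemma coin_swap (Q : pred J) A : measurable A -> 0 < coin A ->
  0 < coin2 [set p | A p.1 /\ A (mix Q id p)].
Proof.
move=> mA A0.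
have [mm lm] := coin_law_mix_id Q.
have mmA : measurable (mix Q id @^-1` A) by exact: measurable_preimage.
pose E := [set p : bits J * bits J | A p.1 /\ A (mix Q id p)].
have mE : measurable E.
  by apply: measurableI => //; exact: (measurable_preimage (@measurable_fst _ _ (bits J) (bits J))).
rewrite lt_neqAle measure_ge0 andbT; apply/eqP => /esym E0.
pose f (x : bits J) := coin [set y | A (mix Q id (x, y))].
pose F := [set x | 0 < f x].
have e (C : set (bits J * bits J)) x : xsection C x = [set y | C (x, y)].
  by apply/seteqP; split => y; rewrite /xsection /= ?inE.
have mF : measurable F.
  have mf := measurable_fun_xsection coin mmA.
  rewrite [X in measurable X](_ : _ = setT `&` [set x | 0 < (coin \o xsection (mix Q id @^-1` A)) x]).
    exact: measurable_realfun.emeasurable_fun_o_infty.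
  by rewrite setTI; apply/seteqP; split => x; rewrite /F /f /= e.
have mAF : measurable (A `&` F) by exact: measurableI.
have E1 x : A x -> [set y | E (x, y)] = [set y | A (mix Q id (x, y))].
  by move=> Ax; apply/seteqP; split => y //= [].
have E2 x : ~ A x -> [set y | E (x, y)] = set0.
  by move=> nAx; apply/seteqP; split => y //= [].
have EF : [set x | 0 < coin [set y | E (x, y)]] = A `&` F.
  apply/seteqP; split => x.
    move=> /= h; have [Ax|nAx] := pselect (A x).
      by split => //; move: h; rewrite E1.
    by move: h; rewrite E2 // measure0 ltxx.
  by move=> [Ax Fx] /=; rewrite E1.
have AF0 : coin (A `&` F) = 0 by rewrite -EF; exact: prod_eq0_ae.
suff : coin (A `&` F) = coin A by rewrite AF0 => A00; rewrite -A00 ltxx in A0.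
rewrite -(lm _ mAF) -(lm _ mA); apply: prod_eq => //.
  exact: measurable_preimage.
move=> x.
have fm y : f (mix Q id (x, y)) = f x.
  rewrite /f; congr (coin _); apply/seteqP; split => z /=.
    rewrite (_ : mix Q id (mix Q id (x, y), z) = mix Q id (x, z)) //.
    by apply/funext => j; rewrite /mix /=; case: (Q j).
  rewrite (_ : mix Q id (mix Q id (x, y), z) = mix Q id (x, z)) //.
  by apply/funext => j; rewrite /mix /=; case: (Q j).
have [fx|fx] := ltP 0 (f x).
  congr (coin _); apply/seteqP; split => y /=; first by case.
  by move=> ?; split => //; rewrite /F /= fm.
have f0 : f x = 0 by apply/eqP; rewrite eq_le fx measure_ge0.
transitivity (f x); last by [].
rewrite f0 [X in coin X](_ : _ = set0) ?measure0 //.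
by apply/seteqP; split => y //= [_]; rewrite /F /= fm f0 ltxx.
Qed.

End CoinLaws.

(** * Matrices of digits *)

(** The two exceptional sets cost at most a quarter of E each, which leaves at least half of its
    measure to E'. *)
Lemma gt0_sub_cover d (T : measurableType d) (R : realType) (P : probability T R)
    (E E' B1 B2 : set T) :
  measurable E -> measurable E' -> measurable B1 -> measurable B2 ->
  E `<=` E' `|` (B1 `|` B2) -> (0 < P E)%E ->
  (P B1 <= (fine (P E) / 4)%:E)%E -> (P B2 <= (fine (P E) / 4)%:E)%E ->
  (0 < P E')%E.
Proof.
move=> mE mE' m1 m2 sub E0 h1 h2.
have PE : P E = (fine (P E))%:E by rewrite fineK ?fin_num_measure.
move: E0 h1 h2; rewrite PE lte_fin [fine (fine _)%:E]/=; set e := fine (P E) => e0 h1 h2.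
rewrite ltNge; apply/negP => E'0.
have : (P E <= 0%:E + ((e / 4)%:E + (e / 4)%:E))%E.
  apply: (@le_trans _ _ (P (E' `|` (B1 `|` B2)))).
    apply: le_measure; rewrite ?inE //.
    by apply: measurableU => //; exact: measurableU.
  apply: (le_trans (measureU2 _ _ _)) => //; first exact: measurableU.
  by apply: leeD => //; apply: (le_trans (measureU2 _ _ _)) => //; exact: leeD.
by rewrite PE -/e -!EFinD lee_fin; lra.
Qed.

Lemma fine_prob_gt0 d (T : measurableType d) (R : realType) (P : probability T R)
  (A : set T) : measurable A -> (0 < P A)%E -> 0 < fine (P A) / 4.
Proof.
move=> mA A0; rewrite divr_gt0 // fine_gt0 // A0 /=.
by rewrite (le_lt_trans (probability_le1 _ mA)) ?ltry.
Qed.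

Section Matrices.
Local Open Scope ereal_scope.
Variables (R : realType) (k : nat).

(** The index (m, (r, c)) names the coefficient of t^m in row r and column c, so the points of
    [bits J] are matrices over F_2[[t]]. *)
Definition nat_index : countType := (nat * ('I_k.+1 * 'I_k.+1))%type.
Notation J := nat_index.
Notation L := (@ord_max k).
Notation coin := (coin R J).
Notation coin2 := (coin2 R J).

(* On the last column, [splice N (x, y)] is t^N x + (y mod t^N) and [tcol N c] is t^N c. *)
Definition splice N (p : bits J * bits J) : bits J := fun j =>
  if j.2.2 == L then
    if (j.1 < N)%N then p.2 j else p.1 ((j.1 - N)%N, j.2)
  else p.1 j.

Definition tcol N (c : J -> bool) : bits J := fun j =>
  (j.2.2 == L) && (N <= j.1)%N && c ((j.1 - N)%N, j.2).

(** The scalar matrix t^N, of full rank k + 1: the displacement that k steps miss. *)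
Definition tdiag N : bits J := fun j => (j.1 == N) && (j.2.1 == j.2.2).

Lemma coin_law_splice N : coin_law coin2 (splice N).
Proof.
pose Q (j : J) := (j.2.2 == L) && (j.1 < N)%N.
(* Off the fresh low digits of the last column, this source map is a shift on that column and the
   identity elsewhere, hence injective. *)
pose rho (j : J) : J := if j.2.2 == L then ((j.1 - N)%N, j.2) else j.
rewrite (_ : splice N = mix Q rho); last first.
  apply/funext => p; apply/funext => j; rewrite /splice /mix /Q /rho.
  by case: ifP.
apply: coin_law_mix => -[m [r c]] [m' [r' c']]; rewrite /Q /rho !inE /=.
have [->|cL] := eqVneq c L; have [->|c'L] := eqVneq c' L => /=.
- rewrite -!leqNgt => Nm Nm' [e ->]; congr (_, _).
  by rewrite -(subnK Nm) e subnK.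
- by move=> _ _ [_ _ e]; rewrite e eqxx in c'L.
- by move=> _ _ [_ _ e]; rewrite -e eqxx in cL.
- by [].
Qed.

(** As N grows, both spliced points converge coordinatewise to x with its last column replaced by
    that of y, since t^N c tends to 0. [coin_swap] gives the limit event positive probability,
    [coin_law_cvg] passes to a finite N, and Fubini fixes y. *)
Lemma step_coin (A : set (bits J)) (c : J -> bool) : measurable A -> 0 < coin A ->
  exists N (y : bits J), 0 < coin [set x | [/\ A x, A (splice N (x, y)) &
    A (xorf (splice N (x, y)) (tcol N c))]].
Proof.
move=> mA A0.
pose Q (j : J) := j.2.2 == L.
have := @coin_swap R J Q A mA A0; set E := [set p | _] => E0.
pose S N p := splice N p.
pose S' N p := xorf (splice N p) (tcol N c).
have lS' N : coin_law coin2 (S' N).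
  exact: (coin_law_comp (coin_law_splice N) (coin_law_xor R (tcol N c))).
have lQ := coin_law_mix_id R Q.
have e0 : (0 < fine (coin2 E) / 4)%R.
  apply: fine_prob_gt0 => //; apply: measurableI.
    exact: (measurable_preimage (@measurable_fst _ _ (bits J) (bits J))).
  by apply: measurable_preimage => //; case: lQ.
have lim N j p : (j.1 < N)%N -> S N p j = mix Q id p j.
  by move=> jN; rewrite /S /splice /mix /Q jN.
have lS N : coin_law coin2 (S N) by exact: coin_law_splice.
have cS j : exists N0, forall N, (N0 <= N)%N -> forall p, S N p j = mix Q id p j.
  by exists j.1.+1 => N jN p; exact: lim.
have cS' j : exists N0, forall N, (N0 <= N)%N -> forall p, S' N p j = mix Q id p j.
  exists j.1.+1 => N jN p; rewrite /S' /xorf -/(S N p j) lim // /tcol.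
  by rewrite [(N <= _)%N]leqNgt jN andbF addbF.
have [N1 h1] := coin_law_cvg lS lQ cS mA e0.
have [N2 h2] := coin_law_cvg lS' lQ cS' mA e0.
move: h1 h2 => /(_ _ (leq_maxl N1 N2)) h1 /(_ _ (leq_maxr N1 N2)) h2.
set N := maxn N1 N2 in h1 h2.
have mS : measurable_fun setT (S N) by case: (coin_law_splice N).
have mS' : measurable_fun setT (S' N) by case: (lS' N).
have mQ : measurable_fun setT (mix Q id) by case: lQ.
have mfst : measurable [set p : bits J * bits J | A p.1].
  exact: (measurable_preimage (@measurable_fst _ _ (bits J) (bits J))).
exists N.
apply: (@prod_gt0_r _ _ _ _ _ _ _ [set p : bits J * bits J | [/\ A p.1, A (S N p) & A (S' N p)]]).
  rewrite [X in measurable X](_ : _ = [set p : bits J * bits J | A p.1] `&`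
    (S N @^-1` A `&` S' N @^-1` A)).
    by apply: measurableI => //; apply: measurableI; exact: measurable_preimage.
  by apply/seteqP; split => p /= [Ap]; [move=> AS AS'|case=> AS AS'].
apply: (@gt0_sub_cover _ _ _ coin2 E _ _ _ _ _ _ _ _ E0 h1 h2).
- by apply: measurableI => //; exact: measurable_preimage.
- rewrite [X in measurable X](_ : _ = [set p : bits J * bits J | A p.1] `&`
    (S N @^-1` A `&` S' N @^-1` A)).
    by apply: measurableI => //; apply: measurableI; exact: measurable_preimage.
  by apply/seteqP; split => p /= [Ap]; [move=> AS AS'|case=> AS AS'].
- by apply: measurableD; exact: measurable_preimage.
- by apply: measurableD; exact: measurable_preimage.
move=> p [Ap Aq] /=.
have [AS|nAS] := pselect (A (S N p)); last by right; left.
have [AS'|nAS'] := pselect (A (S' N p)); last by right; right.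
by left.
Qed.

(** The translations by t^N tend to the identity coordinatewise, so for large N they move little of
    A out of A. *)
Lemma diag_overlap (A : set (bits J)) : measurable A -> 0 < coin A ->
  exists N, 0 < coin [set x | A x /\ A (xorf x (tdiag N))].
Proof.
move=> mA A0.
have e0 : (0 < fine (coin A) / 4)%R.
  exact: fine_prob_gt0.
have lS N : coin_law coin (fun x : bits J => xorf x (tdiag N)) by exact: coin_law_xor.
have lid : coin_law coin (id : bits J -> bits J) by split.
have cS (j : J) : exists N0, forall N, (N0 <= N)%N -> forall x : bits J,
    xorf x (tdiag N) j = x j.
  by exists j.1.+1 => N jN x; rewrite /xorf /tdiag (ltn_eqF jN) addbF.
have [N /(_ N (leqnn _)) h] := coin_law_cvg lS lid cS mA e0.
exists N.
have mx : measurable ((fun x : bits J => xorf x (tdiag N)) @^-1` A).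
  by apply: measurable_preimage => //; case: (coin_law_xor R (tdiag N)).
have h0 : coin set0 <= (fine (coin A) / 4)%:E by rewrite measure0 lee_fin ltW.
apply: (@gt0_sub_cover _ _ _ coin A _ _ _ _ _ _ _ _ A0 h h0) => //.
- exact: measurableI.
- exact: measurableD.
by move=> x Ax; have [?|?] := pselect (A (xorf x (tdiag N))); [left|right; left].
Qed.

End Matrices.

(** * The action *)

Section Action.
Variables (R : realType) (k : nat).
Notation L := (@ord_max k).
Notation J := (nat_index k).

(* [bits int_index] is the group of all two-sided sequences of matrices, which contains the Laurent series as a Borel subset; [mu] below is carried by the power series, the range of [embed]. *)
Definition int_index : countType := (int * ('I_k.+1 * 'I_k.+1))%type.
Notation I := int_index.
Implicit Types (x y : bits I) (i : I).

(* Multiplication of the last column by t^(-s). *)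
Definition colshift (s : int) x : bits I := fun i =>
  if i.2.2 == L then x (i.1 + s, i.2) else x i.

(** For j = L the guard gives the identity; adding the last column to itself would erase it in
    characteristic 2. *)
Definition addcol (j : 'I_k.+1) x : bits I := fun i =>
  if (i.2.2 == j) && (j != L) then x i (+) x (i.1, (i.2.1, L)) else x i.

Definition dot i : bits I := fun i' => i' == i.

Definition flip i x : bits I := xorf x (dot i).

(** Generator 0 rescales the last column, generators 1 to k add it to columns 0 to k - 1, and the
    remaining k + 1 translate it by unit vectors. The latter two kinds are involutions, so the sign
    of the letter only matters for generator 0. *)
Definition ltr (l : 'I_(2 * k + 2) * bool) : bits I -> bits I :=
  if l.1 == 0%N :> nat then colshift (if l.2 then -1 else 1)
  else if (l.1 <= k)%N then addcol (inord l.1.-1)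
  else flip (0, (inord (l.1 - k.+1), L)).

Lemma colshiftD s t x : colshift s (colshift t x) = colshift (s + t) x.
Proof.
apply/funext => i; rewrite /colshift /=; case: eqP => //= _.
by rewrite addrA.
Qed.

Lemma colshift0 x : colshift 0 x = x.
Proof.
apply/funext => -[m rc]; rewrite /colshift /= addr0.
by case: ifP.
Qed.

Lemma addcolK j : involutive (addcol j).
Proof.
move=> x; apply/funext => i; rewrite /addcol /=.
have [/andP[ij jL]|//] := boolP ((i.2.2 == j) && (j != L)).
by rewrite [L == j]eq_sym (negbTE jL) addbK.
Qed.

Lemma addcolD j x y : addcol j (xorf x y) = xorf (addcol j x) (addcol j y).
Proof.
apply/funext => i; rewrite /addcol /xorf; case: (_ && _) => //.
by rewrite -!addbA; congr (_ (+) _); rewrite addbCA.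
Qed.

Lemma ltrK l : cancel (ltr l) (ltr (letterV l)).
Proof.
move=> x; rewrite /ltr /=; case: ifP => _.
  by rewrite colshiftD; case: l.2; rewrite ?subrr ?addNr colshift0.
by case: ifP => _; [rewrite addcolK|rewrite /flip xorfK].
Qed.

Lemma measurable_ltr l : measurable_fun setT (ltr l).
Proof.
apply: measurable_bits => i; rewrite /ltr; case: ifP => _.
  suff : measurable [set x : bits I |
    if i.2.2 == L then x (i.1 + (if l.2 then -1 else 1), i.2) else x i] by [].
  by case: (_ == L); exact: measurable_bit.
case: ifP => _.
  suff : measurable [set x : bits I | if (i.2.2 == inord l.1.-1) &&
    (inord l.1.-1 != L) then x i (+) x (i.1, (i.2.1, L)) else x i] by [].
  case: (_ && _); last exact: measurable_bit.
  set b := (i.1, _).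
  rewrite [X in measurable X](_ : _ = ([set x : bits I | x i] `\` [set x | x b]) `|`
    ([set x | x b] `\` [set x | x i])).
    by apply: measurableU; apply: measurableD; exact: measurable_bit.
  apply/seteqP; split => x /=; last by move=> [[]|[]]; case: (x i); case: (x b).
  by case: (x i); case: (x b) => //= _; [left|right].
rewrite /flip.
have h : measurable_fun setT (fun x : bits I => xorf x (dot (0, (inord (l.1 - k.+1), L)))).
  by apply: measurable_xorf => //; exact: measurable_cst.
exact: (measurable_fun_bit i h).
Qed.

Notation G := (free_group 'I_(2 * k + 2)).

Definition actw (s : seq ('I_(2 * k + 2) * bool)) x : bits I := foldr ltr x s.

Lemma actw_cat s t x : actw (s ++ t) x = actw s (actw t x).
Proof. exact: foldr_cat. Qed.

Lemma actw_reduce s x : actw (reduce s) x = actw s x.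
Proof.
elim: s => [//|l s IH] /=; rewrite -IH.
case: (reduce s) => [//|y u] /=; case: eqVneq => [->|//].
by rewrite -{1}[l]letterVK ltrK.
Qed.

Lemma measurable_actw s : measurable_fun setT (actw s).
Proof.
elim: s => [|l s IH]; first exact: measurable_id.
by apply: (measurableT_comp (measurable_ltr l)).
Qed.

Definition actg (g : G) : bits I -> bits I := actw g.

HB.instance Definition _ (g : G) :=
  isMeasurableFun.Build _ _ _ _ (actg g) (measurable_actw g).

Lemma actg1 x : actg 1%g x = x. Proof. by []. Qed.

Lemma actgM g h x : actg (g * h)%g x = actg g (actg h x).
Proof. by rewrite /actg actw_reduce actw_cat. Qed.

Definition action : borel_action G (bits I) :=
  @BorelAction G _ (bits I) (fun g => actg g) actg1 actgM.

Lemma actgK g : cancel (actg g) (actg g^-1%g).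
Proof. by move=> x; rewrite -actgM mulVg. Qed.

Lemma actgVK g : cancel (actg g^-1%g) (actg g).
Proof. by move=> x; rewrite -actgM mulgV. Qed.

Lemma actg_image g (A : set (bits I)) : actg g @` A = actg g^-1%g @^-1` A.
Proof.
apply/seteqP; split => [_ [x Ax <-]|x Ax] /=; first by rewrite actgK.
by exists (actg g^-1%g x) => //; rewrite actgVK.
Qed.

Lemma measurable_actg g (A : set (bits I)) : measurable A -> measurable (actg g @^-1` A).
Proof. by apply: measurable_preimage; exact: measurable_actw. Qed.

Lemma measurable_image_actg g (A : set (bits I)) :
  measurable A -> measurable (actg g @` A).
Proof. by rewrite actg_image; exact: measurable_actg. Qed.

Definition realized (f : bits I -> bits I) := exists g : G, actg g =1 f.

Lemma realized_comp f h : realized f -> realized h -> realized (f \o h).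
Proof. by move=> [a ha] [b hb]; exists (a * b)%g => x; rewrite actgM ha hb. Qed.

Lemma realized_id : realized id.
Proof. by exists 1%g. Qed.

Lemma realized_ext f h : f =1 h -> realized f -> realized h.
Proof. by move=> fh [a ha]; exists a => x; rewrite ha fh. Qed.

Lemma realized_ltr l : realized (ltr l).
Proof. by exists (@FreeGroup _ [:: l] isT). Qed.

Lemma gen_subproof0 : (0 < 2 * k + 2)%N. Proof. by rewrite addn2. Qed.

Lemma realized_colshift s : realized (colshift s).
Proof.
have r1 : realized (colshift 1) := realized_ltr (Ordinal gen_subproof0, false).
have rN1 : realized (colshift (-1)) := realized_ltr (Ordinal gen_subproof0, true).
case: s => m; elim: m => [|m IH].
- by apply: realized_ext realized_id => x; rewrite colshift0.
- apply: realized_ext (realized_comp r1 IH) => x /=.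
  by rewrite colshiftD -intS.
- exact: rN1.
- apply: realized_ext (realized_comp rN1 IH) => x /=.
  by rewrite colshiftD !NegzE [in RHS]intS opprD.
Qed.

Lemma realized_addcol (j : 'I_k.+1) : realized (addcol j).
Proof.
have [->|jL] := eqVneq j L.
  apply: realized_ext realized_id => x; apply/funext => i.
  by rewrite /addcol eqxx andbF.
have jk : (j < k)%N.
  by rewrite ltn_neqAle -ltnS ltn_ord andbT; apply: contra jL => /eqP jk; exact/eqP/val_inj.
have lt : (j.+1 < 2 * k + 2)%N by lia.
have := realized_ltr (Ordinal lt, false).
rewrite /ltr /= jk (_ : inord j = j) //.
by apply: val_inj; rewrite /= inordK.
Qed.

Lemma realized_flip0 (r : 'I_k.+1) : realized (flip (0, (r, L))).
Proof.
have lt : (r + k.+1 < 2 * k + 2)%N by have := ltn_ord r; lia.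
have := realized_ltr (Ordinal lt, false).
rewrite /ltr /= addnS /= ltnNge leq_addl /= subSS addnK (_ : inord r = r) //.
by apply: val_inj; rewrite /= inordK.
Qed.

(** Conjugating the translation at exponent 0 by a power of the shift moves it to any exponent. *)
Lemma realized_flip i : i.2.2 == L -> realized (flip i).
Proof.
case: i => z [r c] /= /eqP ->.
have := realized_comp (realized_colshift (- z))
  (realized_comp (realized_flip0 r) (realized_colshift z)).
apply: realized_ext => x; apply/funext => -[z' [r' c']].
rewrite /= /colshift /flip /xorf /dot /=; case: ifP => [/eqP ->|c'L].
  by rewrite eqxx subrK !xpair_eqE subr_eq0.
by rewrite c'L !xpair_eqE c'L !andbF.
Qed.

Lemma realized_xor (s : seq I) : uniq s -> all (fun i => i.2.2 == L) s ->
  realized (fun x => xorf x (fun i => i \in s)).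
Proof.
elim: s => [_ _|i s IH /= /andP[is_ us] /andP[iL sL]].
  by apply: realized_ext realized_id => x; apply/funext => i; rewrite /xorf addbF.
apply: realized_ext (realized_comp (IH us sL) (realized_flip iL)) => x.
apply/funext => i'; rewrite /= /flip /xorf /dot inE -addbA; congr (_ (+) _).
by have [->|] := eqVneq i' i; rewrite ?(negbTE is_) //= addFb.
Qed.

Definition embed (x : bits J) : bits I := fun i =>
  if i.1 is Posz m then x (m, i.2) else false.

Lemma measurable_embed : measurable_fun setT embed.
Proof.
apply: measurable_bits => -[[m|m] rc].
  suff : measurable [set x : bits J | x (m, rc)] by [].
  exact: measurable_bit.
suff : measurable (set0 : set (bits J)).
  by congr (measurable _); apply/seteqP; split.
exact: measurable0.
Qed.

HB.instance Definition _ := isMeasurableFun.Build _ _ _ _ embed measurable_embed.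

Lemma embed_xor (x y : bits J) : embed (xorf x y) = xorf (embed x) (embed y).
Proof. by apply/funext => -[[m|m] rc]. Qed.

(** The element removes y mod t^N from the last column and then divides that column by t^N. This
    undoes the splice and turns t^N c into c, with a choice depending only on N and y. *)
Lemma splice_act N (y : bits J) : exists g : G, forall (x : bits J) (c : bits J),
  (forall j, j.2.2 != L -> c j = false) ->
  actg g (embed (xorf (splice N (x, y)) (tcol N c))) = embed (xorf x c).
Proof.
(* The finite support of y mod t^N in the last column. *)
pose s : seq I := undup [seq i <- [seq (Posz m, (r, L)) | m <- iota 0 N, r <- enum 'I_k.+1]
  | embed y i].
have sE i : i \in s = [&& (i.1 < N)%R, i.2.2 == L & embed y i].
  rewrite mem_undup mem_filter andbC; case yi: (embed y i); last by rewrite !andbF.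
  rewrite !andbT; case: i yi => -[m|m] [r c] //= _.
  apply/allpairsP/andP => /= [[[m' r'] /=]|[mN /eqP ->]].
    by rewrite mem_iota => -[/andP[_ mN] _ [-> _ ->]].
  by exists (m, r); rewrite mem_iota mem_enum.
have [||g hg] := @realized_xor s; first exact: undup_uniq.
  by apply/allP => i; rewrite sE => /and3P[].
have [h hh] := realized_comp (realized_colshift N) (ex_intro _ g hg).
exists h => x c cL; rewrite hh /=; apply/funext => -[z [r c']].
rewrite /colshift /=; have [->|c'L] := eqVneq c' L; last first.
  rewrite {1}/xorf sE /= (negbTE c'L) andbF addbF; case: z => // m.
  by rewrite /embed /xorf /splice /tcol /= (negbTE c'L) /= addbF cL ?addbF.
rewrite {1}/xorf sE /= eqxx /=.
case: z => m.
  rewrite -PoszD ltz_nat ltnNge leq_addl /= addbF /embed /xorf /splice /tcol /=.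
  by rewrite eqxx ltnNge leq_addl /= addnK.
(* At a negative exponent of the result, a nonnegative source exponent m' is below N, where the
   digit of y has just been cancelled. *)
case zE : (Negz m + N) => [m'|m']; last by rewrite /embed /=.
have m'N : (m' < N)%N by move: zE; rewrite NegzE => /(congr1 (fun u => u + (m.+1)%:Z)); lia.
by rewrite ltz_nat m'N /embed /xorf /splice /tcol /= eqxx m'N [(N <= _)%N]leqNgt m'N /= addbF addbb.
Qed.

Definition sheared (j : 'I_k.+1) (x : bits J) : bits J := fun i : J =>
  (i.2.2 == j) && (j != L) && x (i.1, (i.2.1, L)).

Lemma addcol_embed j (x : bits J) : addcol j (embed x) = embed (xorf x (sheared j x)).
Proof.
by apply/funext => -[[m|m] [r c]]; rewrite /addcol /embed /xorf /sheared /=;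
   case: (_ && _); rewrite /= ?addbF.
Qed.

(** A shear: column j changes by an amount read off the last column. *)
Lemma coin_law_addcol j : coin_law (coin R J) (fun x : bits J => xorf x (sheared j x)).
Proof.
apply: (@coin_law_shear R J (fun i : J => (i.2.2 == j) && (j != L))).
- apply: measurable_bits => i.
  suff : measurable [set x : bits J | (i.2.2 == j) && (j != L) && x (i.1, (i.2.1, L))] by [].
  case: ((i.2.2 == j) && (j != L)) => /=; first exact: measurable_bit.
  suff : measurable (set0 : set (bits J)).
    by congr (measurable _); apply/seteqP; split.
  exact: measurable0.
- by move=> x i; rewrite /sheared => /negbTE ->.
- move=> x y h; apply/funext => i; rewrite /sheared.
  have [/andP[_ jL]|//] := boolP ((i.2.2 == j) && (j != L)).
  by rewrite /= h //= [L == j]eq_sym (negbTE jL).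
Qed.

Definition mu : probability (bits I) R := distribution (coin R J) embed.

End Action.

(** * Every displacement is reached in k + 1 steps *)

Section UpperBound.
Local Open Scope ereal_scope.
Variables (R : realType) (k : nat).
Notation L := (@ord_max k).
Notation J := (nat_index k).
Notation I := (int_index k).
Notation coin := (coin R J).
Notation mu := (mu R k).
Notation G := (free_group 'I_(2 * k + 2)).
Notation actg := (@actg k).

Lemma measurable_embed_preimage (S : set (bits I)) :
  measurable S -> measurable (@embed k @^-1` S).
Proof. by apply: measurable_preimage; exact: measurable_embed. Qed.

Lemma mu_gt0 (E : set (bits J)) (S : set (bits I)) :
  measurable E -> measurable S -> E `<=` @embed k @^-1` S -> 0 < coin E -> 0 < mu S.
Proof.
move=> mE mS ES /lt_le_trans; apply; apply: le_measure; rewrite ?inE //.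
exact: measurable_embed_preimage.
Qed.

Lemma measurable_xor_preimage (J' : countType) (c : bits J') (A : set (bits J')) :
  measurable A -> measurable [set x : bits J' | A (xorf x c)].
Proof.
move=> mA; apply: (@measurable_preimage _ _ _ _ (fun x : bits J' => xorf x c)) => //.
by apply: measurable_xorf => //; exact: measurable_cst.
Qed.

(** The same g must make gA meet both A and A + c: the first overlap is a link of the chain, the
    second realizes the displacement c. *)
Definition stretchable (c : bits I) := forall A : set (bits I), measurable A ->
  0 < mu A -> exists g : G, 0 < mu (actg g @` A `&` A) /\
    0 < mu (actg g @` A `&` [set x : bits I | A (xorf x c)]).

(** The two spliced points of [step_coin] lie in A, and the element from [splice_act] carries them
    to x and x + c. *)
Lemma stretchable_last (c : bits J) : (forall j, j.2.2 != L -> c j = false) ->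
  stretchable (embed c).
Proof.
move=> cL A mA A0.
have mA' := measurable_embed_preimage mA; set A' := _ @^-1` A in mA'.
have A'0 : 0 < coin A' := A0.
have [N [y]] := step_coin c mA' A'0.
set E := [set x | _] => E0.
have [g hg] := splice_act N y.
have hg0 x : actg g (embed (splice N (x, y))) = embed x.
  have := hg x (fun=> false) (fun _ _ => erefl).
  have -> : xorf x (fun=> false) = x by apply/funext => j; rewrite /xorf addbF.
  have -> : tcol N (fun=> false) = (fun=> false) :> bits J.
    by apply/funext => j; rewrite /tcol andbF.
  by have -> : xorf (splice N (x, y)) (fun=> false) = splice N (x, y)
    by apply/funext => j; rewrite /xorf addbF.
have mpair : measurable_fun setT (fun x : bits J => splice N (x, y)).
  apply: (measurableT_comp (coin_law_splice R k N).1).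
  exact: measurable_pair2.
have mE : measurable E.
  rewrite [X in measurable X](_ : _ = A' `&` ((fun x => splice N (x, y)) @^-1` A' `&`
     (fun x => xorf (splice N (x, y)) (tcol N c)) @^-1` A')); last first.
    by apply/seteqP; split => x /= [Ax]; [move=> Ay Az|case=> Ay Az].
  apply: measurableI => //; apply: measurableI; first exact: measurable_preimage.
  apply: measurable_preimage => //; apply: measurable_xorf => //; exact: measurable_cst.
exists g; split.
- apply: (mu_gt0 mE) => //.
    by apply: measurableI => //; exact: measurable_image_actg.
  move=> x [Ax Ay Az].
  by split => //; exists (embed (splice N (x, y))).
- apply: (@mu_gt0 [set x : bits J | E (xorf x c)]).
  + exact: measurable_xor_preimage.
  + apply: measurableI; first exact: measurable_image_actg.
    exact: measurable_xor_preimage.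
  + move=> x /= [Ax Ay Az]; split; last by rewrite /= -embed_xor.
    by exists (embed (xorf (splice N (xorf x c, y)) (tcol N c))) => //; rewrite hg // xorfK.
  + by rewrite coin_xor.
Qed.

Lemma mu_addcol j (A : set (bits I)) : measurable A -> mu (@addcol k j @^-1` A) = mu A.
Proof.
move=> mA; have [_ h] := coin_law_addcol R j.
transitivity (coin ((fun x : bits J => xorf x (sheared j x)) @^-1` (@embed k @^-1` A))).
  by congr (coin _); apply/seteqP; split => x /=; rewrite addcol_embed.
by apply: h; apply: measurable_preimage => //; exact: measurable_embed.
Qed.

(** Conjugate g by the column addition, which is additive and preserves [mu]. *)
Lemma stretchable_addcol j c : stretchable c -> stretchable (addcol j c).
Proof.
move=> sc A mA A0.
have [s hs] := realized_addcol j.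
have addcolE : @addcol k j = actg s by apply/funext => x; rewrite hs.
have ms B : measurable B -> measurable (@addcol k j @^-1` B).
  by rewrite addcolE; exact: measurable_actg.
have [] := sc (@addcol k j @^-1` A) (ms _ mA); first by rewrite mu_addcol.
move=> g [g1 g2]; exists (s * g * s^-1)%g.
have imE : actg (s * g * s^-1)%g @` A = @addcol k j @^-1` (actg g @` (@addcol k j @^-1` A)).
  apply/seteqP; split => [_ [x Ax <-]|x [y Ay gy]].
    exists (actg s^-1%g x); first by rewrite /= addcolE actgVK.
    by rewrite /= !actgM -addcolE addcolK.
  exists (addcol j y) => //; rewrite !actgM {1}addcolE actgK gy -addcolE.
  by rewrite addcolK.
have mi : measurable (actg g @` (@addcol k j @^-1` A)).
  by apply: measurable_image_actg; exact: ms.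
split.
- rewrite -(mu_addcol j) in g1; last by apply: measurableI => //; exact: ms.
  rewrite (_ : _ `&` A = @addcol k j @^-1` (actg g @` (@addcol k j @^-1` A) `&` @addcol k j @^-1` A)) //.
  by rewrite imE; apply/seteqP; split => x /= [? ?]; split => //; rewrite ?addcolK // -(addcolK j x).
- rewrite -(mu_addcol j) in g2; last first.
    apply: measurableI => //; apply: measurable_xor_preimage; exact: ms.
  rewrite (_ : _ `&` _ = @addcol k j @^-1` (actg g @` (@addcol k j @^-1` A) `&`
    [set x : bits I | (@addcol k j @^-1` A) (xorf x c)])) //.
  by rewrite imE; apply/seteqP; split => x /= [? h]; split => //; move: h; rewrite addcolD addcolK.
Qed.

Fixpoint psum (d : nat -> bits I) n : bits I :=
  if n is m.+1 then xorf (psum d m) (d m) else (fun=> false).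

(** [An] collects points of the n-th translate of A that the sum of the first n displacements brings
    back into A0. Stretching [An] itself, rather than A, preserves the displacements already
    accumulated. *)
Lemma chain_stretchable (d : nat -> bits I) n (A A0 : set (bits I)) :
  measurable A0 -> A0 `<=` A -> 0 < mu A0 -> measurable A ->
  (forall i, (i < n)%N -> stretchable (d i)) ->
  exists (g : nat -> G) (An : set (bits I)),
    [/\ g 0%N = 1%g, (forall i, (i < n)%N -> 0 < mu (actg (g i) @` A `&` actg (g i.+1) @` A)),
        measurable An, 0 < mu An &
        An `<=` actg (g n) @` A `&` [set x : bits I | A0 (xorf x (psum d n))]].
Proof.
move=> mA0 A0A A00 mA; elim: n => [_|n IH sd].
  exists (fun=> 1%g), A0; split => // x A0x; split; first by exists x => //; exact: A0A.
  by rewrite /= (_ : xorf x _ = x) //; apply/funext => i; rewrite /xorf addbF.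
have [g [An [g0 gi mAn An0 Ansub]]] := IH (fun i ni => sd i (ltnW ni)).
have [h [h1 h2]] := sd n (leqnn _) An mAn An0.
pose g' i := if (i <= n)%N then g i else (h * g n)%g.
exists g', (actg h @` An `&` [set x : bits I | An (xorf x (d n))]).
have hsub : actg h @` An `<=` actg (h * g n)%g @` A.
  move=> _ [x /Ansub[[y Ay <-] _] <-]; exists y => //.
  by rewrite actgM.
split => //.
- move=> i; rewrite ltnS leq_eqVlt => /predU1P[->|ni]; last by rewrite /g' (ltnW ni) ni gi.
  rewrite /g' leqnn ltnn; apply: (lt_le_trans h1); apply: le_measure; rewrite ?inE.
  + by apply: measurableI => //; exact: measurable_image_actg.
  + by apply: measurableI; exact: measurable_image_actg.
  + by move=> x [/hsub ? /Ansub[]].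
- by apply: measurableI; [exact: measurable_image_actg|exact: measurable_xor_preimage].
- move=> x [/hsub hx /Ansub[_ /= A0x]]; split; first by rewrite /g' ltnn.
  by rewrite /= [xorf (psum d n) _]xorfC xorfA.
Qed.

Lemma psum_embed (d : nat -> bits J) n : exists p : bits J, psum (fun i => embed (d i)) n = embed p.
Proof.
elim: n => [|n [p IH]]; first by exists (fun=> false); apply/funext => -[[m|m] rc].
by exists (xorf p (d n)); rewrite /= IH embed_xor.
Qed.

(** Choose c with A meeting B + c and split it into k + 1 stretchable displacements. Each of the
    first k produces one column of c and otherwise alters only the last column; the final one,
    supported there, repairs it. *)
Lemma mu_chaining : chaining (action k) mu k.+1.
Proof.
move=> A B mA mB _ _ A0 B0.
have mA' := measurable_embed_preimage mA; have A'0 : 0 < coin (@embed k @^-1` A) := A0.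
have mB' := measurable_embed_preimage mB; have B'0 : 0 < coin (@embed k @^-1` B) := B0.
have [c cAB] := coin_overlap mA' mB' A'0 B'0.
(* Column j of c is placed in the last column; [addcol] then copies it to column j. *)
pose u (j : nat) : bits J := fun i => (i.2.2 == L) && c (i.1, (i.2.1, inord j)).
have sh (j : nat) : addcol (inord j) (embed (u j)) = embed (xorf (u j) (sheared (inord j) (u j))).
  exact: addcol_embed.
pose d0 j := embed (xorf (u j) (sheared (inord j) (u j))).
have [p pE] := psum_embed (fun j => xorf (u j) (sheared (inord j) (u j))) k.
pose d j := if (j < k)%N then d0 j else embed (xorf c p).
have psumE n : (n <= k)%N -> psum d n = psum d0 n.
  by elim: n => // n IH nk; rewrite /= IH ?(ltnW nk) // /d nk.
have pk : psum d k = embed p by rewrite psumE.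
have p0 n (i : I) : (n <= k)%N -> i.2.2 != L ->
    psum d n i = (i.2.2 < n)%N && embed c i.
  move=> + iL; elim: n => [_|n IH nk]; first by [].
  rewrite [psum _ _]/= {1}/xorf IH ?(ltnW nk) // /d nk /d0.
  case: i iL {IH} => -[m|m] [r j] /= jL; last by rewrite /embed !andbF.
  rewrite /embed /= /xorf /sheared /u /= (negbTE jL) /= eqxx /=.
  have inK : (inord n : 'I_k.+1) = n :> nat by rewrite inordK // ltnS ltnW.
  have -> : ((inord n : 'I_k.+1) != L) = true.
    by apply/eqP => /(congr1 (@nat_of_ord _)) /=; rewrite inK => nk'; rewrite nk' ltnn in nk.
  have -> : (j < n.+1)%N = (j == n :> nat) || (j < n)%N by rewrite ltnS leq_eqVlt.
  rewrite andbT.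
  have -> : (j == inord n) = (j == n :> nat) by rewrite -val_eqE /= inK.
  have [jn|jn] := eqVneq (j : nat) n; last by rewrite /= addbF.
  rewrite jn ltnn /=; congr (c (_, (_, _))).
  by apply: val_inj; rewrite /= inK jn.
have sd i : (i < k.+1)%N -> stretchable (d i).
  rewrite ltnS leq_eqVlt /d => /predU1P[->|ik].
    rewrite ltnn; apply: stretchable_last => j jL.
    have := p0 k (Posz j.1, j.2) (leqnn _) jL; rewrite pk /embed /= -surjective_pairing /xorf => ->.
    rewrite (_ : (j.2.2 < k)%N = true) ?addbb //.
    rewrite ltn_neqAle -ltnS ltn_ord andbT.
    by apply: contra jL => /eqP jk; exact/eqP/val_inj.
  rewrite ik /d0 -sh; apply: stretchable_addcol; apply: stretchable_last => j jL.
  by rewrite /u (negbTE jL).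
(* Displacing a point of this set by c lands in B, so the endpoint of the chain does. *)
pose A0' := A `&` [set x : bits I | B (xorf x (embed c))].
have mA0' : measurable A0' by apply: measurableI => //; exact: measurable_xor_preimage.
have A0'0 : 0 < mu A0'.
  move: cAB; congr (_ < coin _).
  by apply/seteqP; split => x /=; rewrite embed_xor.
have A0'A : A0' `<=` A by move=> x [].
have [g [An [g0 gi mAn An0 Ansub]]] := chain_stretchable mA0' A0'A A0'0 mA sd.
exists g; split => //.
apply: (lt_le_trans An0); apply: le_measure; rewrite ?inE //.
  by apply: measurableI => //; exact: measurable_image_actg.
move=> x /Ansub[gA [_ /=]]; rewrite pk /d ltnn -embed_xor.
have -> : xorf p (xorf c p) = c by rewrite xorfC xorfK.
by rewrite xorfK.
Qed.

End UpperBound.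

(** * Displacements reached in k steps have rank at most k *)

Section PolyAction.
Implicit Types (p q : {poly bool}) (s t : int -> bool) (z : int).

(** Multiplication of a formal two-sided series by a polynomial in t, with [bool] as the field F_2;
    t delays by one position. *)
Definition pact p s z : bool := \sum_(m < size p) p`_m * s (z - m%:Z).

Lemma pactE M p s z : (size p <= M)%N ->
  pact p s z = \sum_(m < M) p`_m * s (z - m%:Z).
Proof.
move=> pM; rewrite /pact (big_ord_widen M (fun m => p`_m * s (z - m%:Z))) //.
rewrite big_mkcond /=; apply: eq_bigr => m _; case: ltnP => // h.
by rewrite nth_default // mul0r.
Qed.

Lemma pactD p q s z : pact (p + q) s z = pact p s z + pact q s z.
Proof.
pose M := maxn (size p) (size q).
rewrite (@pactE M) ?size_polyD // (@pactE M p) ?leq_maxl // (@pactE M q) ?leq_maxr //.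
by rewrite -big_split; apply: eq_bigr => m _; rewrite coefD mulrDl.
Qed.

Lemma pact0 s z : pact 0 s z = 0.
Proof. by rewrite /pact size_poly0 big_ord0. Qed.

Lemma pact_sum (T : finType) (p : T -> {poly bool}) s z :
  pact (\sum_c p c) s z = \sum_c pact (p c) s z.
Proof. by apply: (big_morph (fun p => pact p s z)) => [p1 p2|]; rewrite ?pactD ?pact0. Qed.

Lemma pactDr p s t z : pact p (fun i => s i + t i) z = pact p s z + pact p t z.
Proof. by rewrite /pact -big_split; apply: eq_bigr => m _; rewrite mulrDr. Qed.

Lemma pact_shift p s z d : pact p (fun i => s (i + d)) z = pact p s (z + d).
Proof. by apply: eq_bigr => m _; rewrite addrAC. Qed.

Lemma pactMX p s z : pact (p * 'X) s z = pact p s (z - 1).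
Proof.
have h : (size (p * 'X)%R <= (size p).+1)%N.
  by have [->|p0] := eqVneq p 0; rewrite ?mul0r ?size_poly0 // size_mulX.
rewrite (@pactE _ _ s z h) big_ord_recl coefMX eqxx mul0r add0r.
apply: eq_bigr => m _; rewrite coefMX /= /bump /= add1n; congr (_ * s _).
by rewrite intS; ring.
Qed.

Lemma pactZ c q s z : pact (c%:P * q) s z = c * pact q s z.
Proof.
rewrite (@pactE (size q)); last by rewrite mul_polyC size_scale_leq.
by rewrite /pact big_distrr; apply: eq_bigr => m _ /=; rewrite coefCM mulrA.
Qed.

Lemma pactC c s z : pact c%:P s z = c * s z.
Proof.
by rewrite (@pactE 1) ?size_polyC_leq1 // big_ord1 coefC eqxx subr0.
Qed.

Lemma pactXn m s z : pact 'X^m s z = s (z - m%:Z).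
Proof.
elim: m z => [|m IH] z; first by rewrite expr0 -[1]/(1%:P) pactC mul1r subr0.
by rewrite exprSr pactMX IH; congr s; rewrite intS; ring.
Qed.

Lemma pact_mul p q s z : pact p (pact q s) z = pact (p * q) s z.
Proof.
elim/poly_ind: p z => [|p c IH] z; first by rewrite mul0r !pact0.
rewrite mulrDl !pactD pactMX IH pactC pactZ.
by rewrite mulrAC pactMX.
Qed.

Lemma pact_delta p z b : pact p (fun i => (i == z) && b) z = p`_0 && b.
Proof.
rewrite (@pactE (size p).+1) // big_ord_recl subr0 eqxx big1 ?addr0 // => m _.
rewrite (_ : (_ == z) = false) ?mulr0 //.
by rewrite -subr_eq0 addrAC subrr add0r oppr_eq0.
Qed.

Lemma pact_local p s z : (forall i, i <= z -> s i = false) -> pact p s z = false.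
Proof.
by move=> h; rewrite /pact big1 // => m _; rewrite h ?mulr0 // gerBl.
Qed.

End PolyAction.

(** The square matrix padded with a zero column has a nonzero left kernel vector over the polynomial
    ring. While all its constant coefficients vanish it can be divided by t, which must stop because
    a nonzero entry loses degree. *)
Lemma poly_kernel (k : nat) (f : 'I_k -> 'I_k.+1 -> {poly bool}) :
  exists w : 'I_k.+1 -> {poly bool},
    (forall i, \sum_c w c * f i c = 0) /\ exists r, (w r)`_0 = true.
Proof.
pose F : 'M[{poly bool}]_k.+1 :=
  \matrix_(c, i) (if unlift ord_max i is Some j then f j c else 0).
have : \det F == 0.
  rewrite (expand_det_col F ord_max) big1 // => i _.
  by rewrite mxE unlift_none mul0r.
move=> /det0P[v v0 vF].
have vf i : \sum_c v 0 c * f i c = 0.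
  have := congr1 (fun M : 'rV_ _ => M 0 (lift ord_max i)) vF.
  rewrite !mxE => e; rewrite -[RHS]e; apply: eq_bigr => c _.
  by rewrite mxE liftK.
have [c vc] : exists c, v 0 c != 0.
  apply/existsP; apply: contraNT v0 => /existsPn h; apply/eqP/rowP => c.
  by rewrite mxE; apply/eqP; have := h c; rewrite negbK.
have {v v0 vF vf vc} [v [vf vc]] : exists v : 'I_k.+1 -> {poly bool},
    (forall i, \sum_c v c * f i c = 0) /\ v c != 0 by exists (v 0).
have [n] := ubnP (size (v c)).
elim: n v vf vc => // n IH v vf vc; rewrite ltnS => vn.
have [/existsP[r vr]|h] := boolP [exists r, (v r)`_0].
  by exists v; split => //; exists r.
have vE r : v r = drop_poly 1 (v r) * 'X.
  rewrite -[LHS](poly_take_drop 1) expr1 [X in X + _](_ : _ = 0) ?add0r //.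
  apply/polyP => i; rewrite coef_take_poly coef0; case: i => //=.
  by move: h; rewrite negb_exists => /forallP/(_ r)/negbTE.
have X0 : 'X != 0 :> {poly bool} by rewrite polyX_eq0.
apply: (IH (fun r => drop_poly 1 (v r))) => /=.
- move=> i; apply: (mulIf X0); rewrite mul0r -[RHS](vf i) big_distrl.
  by apply: eq_bigr => r _ /=; rewrite [in RHS]vE mulrAC.
- by move: vc; rewrite {1}vE mulf_eq0 negb_or => /andP[].
- rewrite size_drop_poly; apply: leq_trans vn; rewrite subn1 prednK //.
  by rewrite lt0n size_poly_eq0.
Qed.

(** * The product of a point with a vector w as an invariant of chains *)

Section LowerBound.
Variable k : nat.
Notation L := (@ord_max k).
Notation I := (int_index k).
Notation G := (free_group 'I_(2 * k + 2)).
Notation actg := (@actg k).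
Implicit Types (x y : bits I).

(** The linear part of the affine map [ltr l]; translations cancel in differences. *)
Definition llin (l : 'I_(2 * k + 2) * bool) : bits I -> bits I :=
  if l.1 == 0%N :> nat then colshift (if l.2 then -1 else 1)
  else if (l.1 <= k)%N then @addcol k (inord l.1.-1)
  else id.

Definition linw (s : seq ('I_(2 * k + 2) * bool)) x : bits I := foldr llin x s.

Lemma actw_xor s x y : xorf (actw s x) (actw s y) = linw s (xorf x y).
Proof.
elim: s => [//|l s IH] /=; rewrite -IH; move: (actw s x) (actw s y) => a b.
rewrite /ltr /llin; case: ifP => _.
  by apply/funext => i; rewrite /colshift /xorf; case: ifP.
case: ifP => _; first by rewrite addcolD.
by apply/funext => i; rewrite /flip /xorf addbACA addbb addbF.
Qed.

(* Rank one: the linear part of a group element differs from the identity by an operator which only reads the last column. *)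
Lemma linwE s : exists (m : nat) (f : 'I_k.+1 -> {poly bool}), forall x z r c,
  linw s x (z, (r, c)) =
  x (z, (r, c)) + pact (f c) (fun i => x (i, (r, L))) (z + m%:Z).
Proof.
elim: s => [|l s [m [f IH]]].
  by exists 0%N, (fun=> 0) => x z r c; rewrite pact0 addr0.
rewrite /= /llin; case: ifP => _; last (case: ifP => _; last by exists m, f).
  case: l.2.
    (* Relative to the offset m, ['X^m] cancels the unshifted entry and ['X^(m.+1)] supplies the
       shifted one. *)
    pose f' c : {poly bool} := if c == L then f L * 'X + 'X^m + 'X^(m.+1) else f c.
    exists m, f' => x z r c; rewrite {}/f'.
    rewrite /colshift /=; case: eqP => [->|_] /=; rewrite IH //.
    rewrite !pactD pactMX !pactXn.
    have -> : z + m%:Z - 1 = z - 1 + m%:Z by ring.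
    have -> : z + m%:Z - m%:Z = z by ring.
    have -> : z + m%:Z - m.+1%:Z = z - 1 by rewrite intS; ring.
    move: (x (z - 1, _)) (x (z, _)) (pact _ _ _) => a b d.
    by case: a; case: b; case: d.
  (* Dividing by t raises the denominator exponent to m + 1; the other columns gain a factor t to
     compensate. *)
  pose f' c : {poly bool} := if c == L then f L + 'X^m + 'X^(m.+1) else f c * 'X.
  exists m.+1, f' => x z r c; rewrite {}/f'.
  rewrite /colshift /=; case: eqP => [->|_] /=; rewrite IH //; last first.
    by rewrite pactMX; congr (_ + pact _ _ _); rewrite intS; ring.
  rewrite !pactD !pactXn.
  have -> : z + m.+1%:Z - m%:Z = z + 1 by rewrite intS; ring.
  have -> : z + 1 + m%:Z = z + m.+1%:Z by rewrite intS; ring.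
  have -> : z + m.+1%:Z - m.+1%:Z = z by ring.
  move: (x (z + 1, _)) (x (z, _)) (pact _ _ _) => a b d.
  by case: a; case: b; case: d.
set j := inord _.
pose f' c : {poly bool} := if (c == j) && (j != L) then f c + f L + 'X^m else f c.
exists m, f' => x z r c; rewrite {}/f'.
rewrite /addcol /=; case: (_ && _); last exact: IH.
rewrite !IH !pactD pactXn (_ : z + m%:Z - m%:Z = z); last by ring.
move: (x (z, (r, c))) (x (z, (r, L))) (pact (f L) _ _) (pact (f c) _ _) => a b d e.
by case: a; case: b; case: d; case: e.
Qed.

(** The coefficient of t^z in row r of the product of the matrix x with the column vector w. *)
Definition zeta (w : 'I_k.+1 -> {poly bool}) x (z : int) r : bool :=
  \sum_c pact (w c) (fun i => x (i, (r, c))) z.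

Lemma zetaD w x y z r : zeta w (xorf x y) z r = zeta w x z r + zeta w y z r.
Proof. by rewrite /zeta -big_split; apply: eq_bigr => c _; exact: pactDr. Qed.

Lemma zeta_local w x z r : (forall i, i.1 <= z -> x i = false) -> zeta w x z r = 0.
Proof. by move=> h; rewrite /zeta big1 // => c _; apply: pact_local => i iz; exact: h. Qed.

(** The linear part is x q with q - 1 of rank at most one, and orthogonality of w to f gives q w =
    w. *)
Lemma zeta_linw w s m f :
  (forall x z r c, linw s x (z, (r, c)) =
    x (z, (r, c)) + pact (f c) (fun i => x (i, (r, L))) (z + m%:Z)) ->
  \sum_c w c * f c = 0 -> forall x z r, zeta w (linw s x) z r = zeta w x z r.
Proof.
move=> h wf x z r; rewrite /zeta.
under eq_bigr => c _.
  rewrite (_ : (fun i => _) = (fun i => x (i, (r, c)) +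
    pact (f c) (fun i => x (i, (r, L))) (i + m%:Z))); last by apply/funext => i; rewrite h.
  rewrite pactDr (pact_shift _ (pact (f c) (fun i => x (i, (r, L))))) pact_mul.
  over.
by rewrite big_split /= -pact_sum wf pact0 addr0.
Qed.

(** Take w orthogonal to the row vectors of all the linear parts. Modulo t^(N+1), (g_i x) w does not
    depend on x in A, and consecutive translates share a point, so it equals a w all along the
    chain. In B it would be a w + t^N w, contradicting the nonzero constant coefficient of w. *)
Lemma no_chain N (A B : set (bits I)) (g : nat -> G) :
  (forall x y, A x -> A y -> forall i, i.1 <= N%:Z -> x i = y i) ->
  (forall x y, A x -> B y -> forall i, i.1 <= N%:Z -> y i = x i (+) embed (tdiag N) i) ->
  g 0%N = 1%g ->
  (forall i, (i < k)%N -> (actg (g i) @` A `&` actg (g i.+1) @` A) !=set0) ->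
  (actg (g k) @` A `&` B) !=set0 -> False.
Proof.
move=> AA AB g0 gi [_ [[a Aa <-] Bb]].
(* As [g 0] is the identity, only k row vectors occur. *)
have /choice[m /choice[f fE]] := fun i : 'I_k => linwE (g i.+1).
have [w [wf [r wr]]] := poly_kernel f.
have inv i x y z : (i <= k)%N -> A x -> A y -> z <= N%:Z ->
    zeta w (actg (g i) x) z r = zeta w (actg (g i) y) z r.
  move=> ik Ax Ay zN; apply/eqP; rewrite -subr_eq0 (_ : _ - _ = zeta w (actg (g i) x) z r + zeta w (actg (g i) y) z r) //.
  rewrite -zetaD actw_xor.
  have -> : zeta w (linw (g i) (xorf x y)) z r = zeta w (xorf x y) z r.
    case: i ik => [_|i ik]; first by rewrite g0.
    exact: (zeta_linw (fE (Ordinal ik)) (wf (Ordinal ik))).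
  rewrite zeta_local // => j jz; rewrite /xorf (AA x y) ?addbb //.
  exact: le_trans zN.
have all i z : (i <= k)%N -> z <= N%:Z ->
    zeta w (actg (g i) a) z r = zeta w a z r.
  elim: i => [|i IH] ik zN; first by rewrite g0.
  have [_ [[x Ax <-] [y Ay xy]]] := gi _ ik.
  rewrite (inv i.+1 a y) // xy (inv i x a) ?(ltnW ik) //.
  exact: IH (ltnW ik) zN.
have : zeta w (xorf (actg (g k) a) (xorf a (embed (tdiag N)))) N%:Z r = 0.
  apply: zeta_local => i iN.
  by rewrite /xorf (AB a _ Aa Bb i iN) addbb.
rewrite !zetaD all // addrA (_ : zeta w a _ r + zeta w a _ r = 0) ?add0r; last first.
  by case: (zeta w a _ _).
rewrite /zeta (bigD1 r) //= big1 ?addr0 => [|c cr].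
  have -> : (fun i : int => embed (tdiag N) (i, (r, r))) = (fun i => (i == N%:Z) && true).
    by apply/funext => -[i|i]; rewrite /embed /tdiag /= ?eqxx.
  by rewrite pact_delta wr.
have -> : (fun i : int => embed (tdiag N) (i, (r, c))) = (fun i => (i == N%:Z) && false).
  by apply/funext => -[i|i]; rewrite /embed /tdiag /= ?[r == c]eq_sym ?(negbTE cr) ?andbF.
by rewrite pact_delta andbF.
Qed.

End LowerBound.

(** * Standard Borel structure *)

(* The unused argument lets the canonical metric structure, whose values are in [R], be inferred from the type. *)
Definition bitspace (R : realType) (J : countType) : Type := J -> bool.

Section BitSpace.
Variables (R : realType) (J : countType).
Local Notation bitspace := (bitspace R J).

(** Coordinate j has weight 2^(-pickle j), and agreement is asked on all weights at least e.
    Positivity of e is built in because the triangle inequality uses it. *)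
Definition bball (x : bitspace) (e : R) : set bitspace :=
  [set y | 0 < e /\ forall j, e <= (2 ^+ pickle j)^-1 -> x j = y j].

Let ent : set_system (bitspace * bitspace) := entourage_ bball.

HB.instance Definition _ := Pointed.copy bitspace (J -> bool).
HB.instance Definition _ := hasNbhs.Build bitspace (nbhs_ ent).

Let bball_center x (e : R) : 0 < e -> bball x e x. Proof. by []. Qed.

Let bball_sym x y (e : R) : bball x e y -> bball y e x.
Proof. by move=> [e0 h]; split => // j /h. Qed.

Let bball_triangle x y z e1 e2 :
  bball x e1 y -> bball y e2 z -> bball x (e1 + e2) z.
Proof.
move=> [e10 h1] [e20 h2]; split; first exact: addr_gt0.
move=> j h; rewrite h1 ?h2 //; apply: le_trans h.
  by rewrite lerDr ltW.
by rewrite lerDl ltW.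
Qed.

HB.instance Definition _ := @Nbhs_isPseudoMetric.Build R bitspace
  ent erefl bball bball_center bball_sym bball_triangle erefl.

Lemma pow2_lt (e : R) : 0 < e -> exists n, (2 ^+ n)^-1 < e.
Proof.
move=> e0; exists (Num.bound e^-1).
rewrite invf_plt ?posrE ?exprn_gt0 //.
apply: (lt_le_trans (archi_boundP _)); first by rewrite invr_ge0 ltW.
by rewrite -natrX ler_nat ltnW // ltn_expl.
Qed.

Lemma pow2_le (m n : nat) : (m <= n)%N -> (2 ^+ n)^-1 <= (2 ^+ m)^-1 :> R.
Proof.
by move=> mn; rewrite lef_pV2 ?posrE ?exprn_gt0 // ler_weXn2l // ler1n.
Qed.

Lemma bitspace_complete (F : set_system bitspace) :
  ProperFilter F -> cauchy F -> cvg F.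
Proof.
move=> FF /(@cauchyP R) Fc.
have /choice[x xF] : forall n, exists x, F (bball x (2 ^+ n)^-1).
  by move=> n; apply: Fc; rewrite invr_gt0 exprn_gt0.
(* The limit reads coordinate j from an approximation precise enough to fix it. *)
pose y : bitspace := fun j => x (pickle j) j.
apply/cvg_ex; exists y => A /nbhs_ballP[e e0 eA].
have [n ne] := pow2_lt e0.
apply: filterS (xF n) => z [_ xz]; apply: eA; split => // j ej.
have [w [[_ h1] [_ h2]]] := filter_ex (filterI (xF n) (xF (pickle j))).
have nj : (2 ^+ n)^-1 <= (2 ^+ pickle j)^-1 :> R by exact: ltW (lt_le_trans ne ej).
by rewrite /y h2 // -h1 // xz.
Qed.

HB.instance Definition _ := Uniform_isComplete.Build bitspace bitspace_complete.

(** Indexing by finite lists, a countable type, makes the boxes a countable base. *)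
Definition box (s : seq (J * bool)) : set bitspace :=
  [set x | forall p, p \in s -> x p.1 = p.2].

Definition low_bits (x : bitspace) n : seq (J * bool) :=
  [seq (j, x j) | j <- pmap unpickle (iota 0 n) & (pickle j < n)%N].

Lemma box_low_bits x n y : box (low_bits x n) y <-> forall j, (pickle j < n)%N -> y j = x j.
Proof.
split=> [h j jn|h p /mapP[j + ->]] /=.
  apply: (h (j, x j)); apply/mapP; exists j => //; rewrite mem_filter jn /=.
  by rewrite mem_pmap; apply/mapP; exists (pickle j); rewrite ?pickleK // mem_iota.
by rewrite mem_filter => /andP[jn _]; exact: h.
Qed.

Lemma box_open s : open (box s).
Proof.
rewrite openE => x xs; apply/nbhs_ballP.
pose n := (\max_(p <- s) pickle p.1)%N.
exists (2 ^+ n)^-1; first by rewrite /= invr_gt0 exprn_gt0.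
move=> y [_ xy] p ps; rewrite -xs // xy //; apply: pow2_le.
exact: (@leq_bigmax_seq _ s xpredT (fun p => pickle p.1)).
Qed.

Lemma nbhs_box (x : bitspace) A : nbhs x A -> exists s, box s x /\ box s `<=` A.
Proof.
move=> /nbhs_ballP[e e0 eA]; have [n ne] := pow2_lt e0.
exists (low_bits x n); split; first exact/box_low_bits.
move=> y /box_low_bits xy; apply: eA; split => // j ej; apply/esym/xy.
rewrite ltnNge; apply/negP => nj.
by have := lt_le_trans ne (le_trans ej (pow2_le nj)); rewrite ltxx.
Qed.

Lemma bitspace_second_countable : @second_countable bitspace.
Proof.
exists (range box).
  by apply: card_le_trans (card_image_le box setT) _; exact: countableP.
split=> [_ [s _ <-]|x A]; first exact: box_open.
move=> /nbhs_box[s [sx sA]]; exists (box s) => //.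
Qed.

Lemma bitspace_hausdorff : hausdorff_space bitspace.
Proof.
move=> x y /= xy; apply/funext => j.
have nb (z : bitspace) : nbhs z (box [:: (j, z j)]).
  by apply: open_nbhs_nbhs; split; [exact: box_open|move=> p; rewrite inE => /eqP ->].
have [z [zx zy]] := xy _ _ (nb x) (nb y).
have <- : z j = x j := zx (j, x j) (mem_head _ _).
exact: (zy (j, y j) (mem_head _ _)).
Qed.

(** An open set is the union of the countably many boxes inside it, and conversely every cylinder is
    a box. *)
Lemma bitspace_borel (A : set bitspace) : <<s open >> A <-> measurable (A : set (bits J)).
Proof.
have mbox s : measurable (box s : set (bits J)).
  elim: s => [|[j b] s IH].
    rewrite [X in measurable X](_ : _ = setT) //; by apply/seteqP; split.
  rewrite [X in measurable X](_ : _ =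
    (if b then [set x : bits J | x j] else ~` [set x : bits J | x j]) `&` box s).
    apply: measurableI => //; case: b; last apply: measurableC; exact: measurable_bit.
  apply/seteqP; split => x /=.
    move=> h; split; last by move=> p ps; apply: h; rewrite inE ps orbT.
    have /= := h (j, b); rewrite inE eqxx => /(_ isT).
    by case: b {h} => /= -> //.
  move=> [xj xs] p; rewrite inE => /predU1P[-> /=|]; last exact: xs.
  by case: b xj => //= /negP/negbTE.
split.
- apply: smallest_sub; first exact: sigma_algebra_measurable.
  move=> U oU.
  have -> : U = \bigcup_s (if `[< box s `<=` U >] then box s else set0).
    apply/seteqP; split => [x Ux|x [s _]]; last by case: asboolP => // sU /sU.
    have [s [sx sU]] := nbhs_box (open_nbhs_nbhs (conj oU Ux)).
    by exists s => //; case: asboolP.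
  apply: (@countable_bigcupT_measurable _ (bits J)) => [|s]; first exact: countableP.
  by case: ifP => _; [exact: mbox|exact: measurable0].
- apply: smallest_sub; first exact: smallest_sigma_algebra.
  move=> B [->|[t [v [ut ->]]]]; first exact: sigma_algebra0.
  apply: sub_sigma_algebra.
  rewrite (_ : cyl t v = box [seq (j, v j) | j <- t]); first exact: box_open.
  apply/seteqP; split => x h; first by move=> _ /mapP[j jt ->]; exact: h.
  by move=> j jt; apply: (h (j, v j)); apply/mapP; exists j.
Qed.

End BitSpace.

Lemma standard_borel_bits (R : realType) (J : countType) : standard_borel R (bits J).
Proof.
exists (bitspace R J), (fun x => x); split.
- exact: bitspace_hausdorff.
- exact: bitspace_second_countable.
- by exists (fun x => x).
- by move=> A; exact: bitspace_borel.
Qed.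

(** * The nonsingularization *)

Section Nonsingularization.
Local Open Scope ereal_scope.
Variables (R : realType) (k : nat).
Notation L := (@ord_max k).
Notation J := (nat_index k).
Notation I := (int_index k).
Notation coin := (coin R J).
Notation mu := (mu R k).
Notation G := (free_group 'I_(2 * k + 2)).
Notation actg := (@actg k).

(** The matrices of power series. They carry [mu] and later serve as the set W of essential
    chaining. *)
Definition Zset : set (bits I) := [set x | forall i, (i.1 < 0)%R -> x i = false].

Lemma measurable_Zset : measurable Zset.
Proof.
rewrite [X in measurable X](_ : _ = \bigcap_n [set x : bits I |
  if (unpickle n : option I) is Some i then (i.1 < 0)%R ==> ~~ x i else true]).
  apply: bigcap_measurableType => n _; case: (unpickle n : option I) => [i|]; last first.
    by rewrite [X in measurable X](_ : _ = setT) //; apply/seteqP; split.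
  case: (i.1 < 0)%R => /=; last first.
    by rewrite [X in measurable X](_ : _ = setT) //; apply/seteqP; split.
  suff : measurable (~` [set x : bits I | x i]).
    by congr (measurable _); apply/seteqP; split => x /= /negP.
  by apply: measurableC; exact: measurable_bit.
apply/seteqP; split => x /= h.
  by move=> n _ /=; case: (unpickle n : option I) => // i; apply/implyP => /h ->.
by move=> i i0; have := h (pickle i) Logic.I; rewrite /= pickleK i0 /= => /negbTE.
Qed.

Definition restr (x : bits I) : bits J := fun j => x (Posz j.1, j.2).

Lemma embedK : cancel (@embed k) restr.
Proof. by move=> x; apply/funext => -[m rc]. Qed.

Lemma restrK x : Zset x -> embed (restr x) = x.
Proof. by move=> Zx; apply/funext => -[[m|m] rc] //; rewrite /embed /= Zx. Qed.

Lemma Zset_embed x : Zset (embed x).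
Proof. by move=> [[m|m] rc]. Qed.

Lemma measurable_restr : measurable_fun setT restr.
Proof. by apply: measurable_bits => j; exact: measurable_bit. Qed.

Lemma mu_Zset : mu Zset = 1.
Proof.
rewrite -(probability_setT coin); congr (coin _).
by apply/seteqP; split => // x _; exact: Zset_embed.
Qed.

(** At each further coordinate, one of the two halves of the current set keeps positive measure. *)
Lemma exists_cyl (t : seq J) (E : set (bits J)) : uniq t -> measurable E -> 0 < coin E ->
  exists v, 0 < coin (E `&` cyl t v).
Proof.
elim: t E => [|j t IH] E /=.
  move=> _ mE E0; exists (fun=> false); rewrite (_ : cyl _ _ = setT) ?setIT //.
  by apply/seteqP; split.
move=> /andP[jt ut] mE E0; have [v v0] := IH E ut mE E0.
pose V b : J -> bool := fun i => if i == j then b else v i.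
have mV b : measurable (E `&` cyl (j :: t) (V b)).
  by apply: measurableI => //; apply: measurable_cyl; rewrite /= jt.
have [h|h] := ltP 0 (coin (E `&` cyl (j :: t) (V true))); first by exists (V true).
exists (V false); rewrite ltNge; apply/negP => h'.
have : coin (E `&` cyl t v) <= 0 + 0.
  apply: (@le_trans _ _ (coin (E `&` cyl (j :: t) (V true) `|` E `&` cyl (j :: t) (V false)))).
    apply: le_measure; rewrite ?inE.
    - by apply: measurableI => //; exact: measurable_cyl.
    - exact: measurableU.
    - move=> x [Ex xv]; have xV : cyl (j :: t) (V (x j)) x.
        move=> i; rewrite inE /V; case: eqP => [-> //|_ /=]; exact: xv.
      by case: (x j) xV; [left|right].
  by apply: (le_trans (measureU2 _ _ _)) => //; exact: leeD.
by rewrite adde0 leNgt v0.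
Qed.

(** Some t^N moves a positive part of W into W; a cell of W fixing the digits up to t^N and the cell
    translated by t^N satisfy [no_chain]. Chains are excluded even with merely nonempty overlaps, so
    the lemma serves both [mu] and its nonsingularization. *)
Lemma unchained_sets (W : set (bits I)) : measurable W -> 0 < mu W ->
  exists A B : set (bits I), [/\ measurable A, measurable B, A `<=` W, B `<=` W &
    [/\ 0 < mu A, 0 < mu B &
    forall g : nat -> G, g 0%N = 1%g ->
      (forall i, (i < k)%N -> (actg (g i) @` A `&` actg (g i.+1) @` A) !=set0) ->
      (actg (g k) @` A `&` B) !=set0 -> False]].
Proof.
move=> mW W0; have mE := measurable_embed_preimage mW; set E := _ @^-1` W in mE.
have E0 : 0 < coin E := W0.
have [N] := diag_overlap mE E0; set E1 := [set x | _] => E10.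
have mE1 : measurable E1 by apply: measurableI => //; exact: measurable_xor_preimage.
pose t : seq J := undup [seq (m, rc) | m <- iota 0 N.+1, rc <- enum {: 'I_k.+1 * 'I_k.+1}].
have tE (j : J) : (j.1 <= N)%N -> j \in t.
  case: j => m rc /= mN; rewrite mem_undup; apply/allpairsP; exists (m, rc).
  by rewrite mem_iota mem_enum.
have ut : uniq t by exact: undup_uniq.
have [v v0] := exists_cyl ut mE1 E10.
have mc w : measurable (cyl t w : set (bits J)) by exact: measurable_cyl.
(* Intersecting with [Zset] also fixes the digits at negative exponents, as [no_chain] requires. *)
pose A : set (bits I) := W `&` (Zset `&` restr @^-1` cyl t v).
pose B : set (bits I) := W `&` (Zset `&` restr @^-1` cyl t (xorf v (tdiag N))).
have mr w : measurable (W `&` (Zset `&` restr @^-1` cyl t w)).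
  apply: measurableI => //; apply: measurableI; first exact: measurable_Zset.
  exact: (measurable_preimage measurable_restr).
exists A, B; split; [exact: mr|exact: mr|by move=> x []|by move=> x []|].
have mv : measurable (E1 `&` cyl t v) by exact: measurableI.
split.
- apply: (mu_gt0 mv); [exact: mr| |exact: v0].
  move=> x [[Ex _] xv]; split => //.
  by split; [exact: Zset_embed|rewrite /= embedK].
- apply: (@mu_gt0 _ _ [set x : bits J | (E1 `&` cyl t v) (xorf x (tdiag N))]).
  + exact: measurable_xor_preimage.
  + exact: mr.
  + move=> x /= [[_ Ex] xv]; rewrite xorfK in Ex; split=> //.
    split; [exact: Zset_embed|rewrite /= embedK => j jt].
    by rewrite /xorf -(xv j jt) /xorf addbK.
  + by rewrite coin_xor.
- move=> g; apply: (@no_chain k N A B).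
  + move=> x y [_ [Zx xv]] [_ [Zy yv]] [[m|m] rc] /= mN; last by rewrite Zx ?Zy.
    have mt : (m, rc) \in t by exact: tE.
    by rewrite (xv _ mt : x (Posz m, rc) = _) (yv _ mt : y (Posz m, rc) = _).
  + move=> x y [_ [Zx xv]] [_ [Zy yv]] [[m|m] rc] /= mN; last by rewrite Zx ?Zy.
    have mt : (m, rc) \in t by exact: tE.
    by rewrite (xv _ mt : x (Posz m, rc) = _) (yv _ mt : y (Posz m, rc) = _).
Qed.

(* Null sets of the Haar measure of the Laurent series, of which [mu] is the restriction to power series. *)
Definition null (S : set (bits I)) := measurable S /\
  forall c, mu [set x : bits I | S (xorf x c)] = 0.

(** Translation by a power series preserves [coin]; translation by anything else moves [Zset] off
    itself. *)
Lemma null_Zset A : measurable A -> A `<=` Zset -> mu A = 0 -> null A.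
Proof.
move=> mA AZ A0; split => // c; have [Zc|nZc] := pselect (Zset c).
  rewrite -A0 -[RHS](coin_xor R (restr c)); last first.
    exact: measurable_embed_preimage.
  by congr (coin _); apply/seteqP; split => x /=; rewrite embed_xor restrK.
rewrite -[RHS](measure0 coin); congr (coin _).
apply/seteqP; split => x //= /AZ h; apply: nZc => i i0.
by have := h i i0; rewrite /xorf (Zset_embed x i0) addFb.
Qed.

Lemma ltr_xor (l : 'I_(2 * k + 2) * bool) (x y : bits I) :
  ltr l (xorf x y) = xorf (ltr l x) (llin l y).
Proof.
rewrite /ltr /llin; case: ifP => _.
  by apply/funext => i; rewrite /colshift /xorf; case: ifP.
case: ifP => _; first by rewrite addcolD.
by apply/funext => i; rewrite /flip /xorf addbAC.
Qed.

(** Dividing the last column of a splice by t yields x plus a displacement at exponent -1 determined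
    by y, so each y contributes the measure of a translate of S, which is 0. *)
Lemma mu_colshift1 S : null S -> mu (@colshift k 1 @^-1` S) = 0.
Proof.
move=> [mS S0]; have [s hs] := realized_colshift k 1.
have mcS : measurable (@colshift k 1 @^-1` S).
  have -> : @colshift k 1 = actg s by apply/funext => x; rewrite hs.
  exact: measurable_actg.
have miS : measurable (@embed k @^-1` (@colshift k 1 @^-1` S)).
  exact: measurable_embed_preimage.
have [ms ls] := coin_law_splice R k 1.
transitivity (coin2 R J (splice 1 @^-1` (@embed k @^-1` (@colshift k 1 @^-1` S)))).
  by rewrite ls.
apply/eqP; rewrite eq_le measure_ge0 andbT leNgt; apply/negP => h.
have [y] := prod_gt0_r (measurable_preimage ms miS) h.
pose d : bits I := fun i => (i.1 == -1)%R && (i.2.2 == L) && y (0%N, i.2).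
have dE x : colshift 1 (embed (splice 1 (x, y))) = xorf (embed x) d.
  apply/funext => -[z [r c]]; rewrite /colshift /xorf /d /=.
  have [->|cL] := eqVneq c L; last first.
    by rewrite andbF addbF; case: z => m; rewrite /embed //= /splice /= (negbTE cL).
  case: z => [m|[|m]]; rewrite /embed /splice /= ?eqxx ?addbF //.
  by rewrite addn1 subn1.
rewrite [X in 0 < coin X](_ : _ = @embed k @^-1` [set x : bits I | S (xorf x d)]).
  by rewrite [X in 0 < X](S0 d) ltxx.
by apply/seteqP; split => x /=; rewrite dE.
Qed.

(** Multiplying the last column by t gives a random point conditioned on zero constant digits there.
    This event C has positive probability and is independent of x, so a positive preimage would make
    S positive. *)
Lemma mu_colshiftN1 S : null S -> mu (@colshift k (-1) @^-1` S) = 0.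
Proof.
move=> [mS S0]; have [s hs] := realized_colshift k (-1).
have mcS : measurable (@colshift k (-1) @^-1` S).
  have -> : @colshift k (-1) = actg s by apply/funext => x; rewrite hs.
  exact: measurable_actg.
have [ms ls] := coin_law_splice R k 1.
pose t : seq J := [seq (0%N, (r, L)) | r <- enum 'I_k.+1].
have ut : uniq t by rewrite map_inj_uniq ?enum_uniq // => r r' [].
pose C : set (bits J) := cyl t (fun=> false).
have mC : measurable C by exact: measurable_cyl.
have C0 : 0 < coin C.
  by rewrite coin_cyl // lte_fin invr_gt0 exprn_gt0.
have lC (x y : bits J) : C y -> colshift (-1) (embed x) = embed (splice 1 (x, y)).
  move=> Cy; apply/funext => -[z [r c]]; rewrite /colshift /=.
  have [->|cL] := eqVneq c L; last first.
    by case: z => m; rewrite /embed //= /splice /= (negbTE cL).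
  case: z => [[|m]|m]; rewrite /embed /splice //= eqxx /=.
    by rewrite Cy //; apply/mapP; exists r; rewrite ?mem_enum.
  by rewrite subn1.
apply/eqP; rewrite eq_le measure_ge0 andbT leNgt; apply/negP => h.
have : coin (@embed k @^-1` (@colshift k (-1) @^-1` S)) * coin C <= 0.
  rewrite -(S0 (fun=> false)).
  have -> : [set x : bits I | S (xorf x (fun=> false))] = S.
    by apply/seteqP; split => x /=;
       rewrite (_ : xorf x _ = x) //; apply/funext => i; rewrite /xorf addbF.
  rewrite (_ : mu S = coin2 R J (splice 1 @^-1` (@embed k @^-1` S))); last first.
    by rewrite ls //; exact: measurable_embed_preimage.
  rewrite (_ : _ * _ = coin2 R J ((@embed k @^-1` (@colshift k (-1) @^-1` S)) `*` C)); last first.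
    by apply/esym; apply: product_measure1E => //; exact: measurable_embed_preimage.
  apply: le_measure; rewrite ?inE.
  - by apply: measurableX => //; exact: measurable_embed_preimage.
  - by apply: (measurable_preimage ms); exact: measurable_embed_preimage.
  - by move=> [x y] [/= Sx Cy]; rewrite -lC.
by rewrite leNgt mule_gt0.
Qed.

(** A translation by c before the letter is a translation by its linear image after it, so each kind
    of letter needs treatment only for c = 0. *)
Lemma null_ltr l S : null S -> null (@ltr k l @^-1` S).
Proof.
move=> nS; have [mS S0] := nS; split.
  by apply: measurable_preimage => //; exact: measurable_ltr.
move=> c; pose S' := [set x : bits I | S (xorf x (llin l c))].
have nS' : null S'.
  split; first exact: measurable_xor_preimage.
  move=> c'; rewrite -[RHS](S0 (xorf c' (llin l c))); congr (coin _).
  by apply/seteqP; split => x; rewrite /S' /= xorfA.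
rewrite (_ : [set x : bits I | _] = @ltr k l @^-1` S'); last first.
  by apply/seteqP; split => x; rewrite /S' /= ltr_xor.
have [mS' S'0] := nS'.
have S'00 : mu S' = 0.
  rewrite -[RHS](S'0 (fun=> false)); congr (coin _).
  by apply/seteqP; split => x /=;
     rewrite (_ : xorf _ (fun=> false) = embed x) //; apply/funext => i; rewrite /xorf addbF.
rewrite /ltr; case: ifP => _.
  by case: l.2; [exact: mu_colshiftN1|exact: mu_colshift1].
case: ifP => _; first by rewrite mu_addcol.
exact: S'0.
Qed.

Lemma null_actg g S : null S -> null (actg g @^-1` S).
Proof.
rewrite /actg; elim: (word g) S => // l s IH S nS.
rewrite (_ : _ @^-1` S = actw s @^-1` (@ltr k l @^-1` S)) //.
by apply: IH; exact: null_ltr.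
Qed.

(** Subsets of [Zset] that are [mu]-null satisfy [null], which every group element preserves. *)
Lemma mu_quasi_invariant g A : measurable A -> A `<=` Zset ->
  0 < mu (actg g @^-1` A) -> 0 < mu A.
Proof.
move=> mA AZ h; rewrite lt_neqAle measure_ge0 andbT; apply/eqP => /esym A0.
have [_ /(_ (fun=> false))] := null_actg g (null_Zset mA AZ A0).
rewrite (_ : [set x : bits I | _] = actg g @^-1` A).
  by move=> h0; rewrite h0 ltxx in h.
by apply/seteqP; split => x /=;
   rewrite (_ : xorf x (fun=> false) = x) //; apply/funext => i; rewrite /xorf addbF.
Qed.

(** * Essential chaining of the nonsingularization *)

Section Enumeration.
Variable gamma : nat -> G.
Hypothesis gamma_surj : forall g, exists2 n : nat, (1 <= n)%N & gamma n = g.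
Notation mt := (nonsingularization (action k) mu gamma).

Lemma mtE (S : set (bits I)) : mt S =
  \sum_(1 <= n <oo) ((2 ^- n : R)%R%:E * mu (actg (gamma n) @^-1` S)).
Proof. by []. Qed.

Lemma mt_gt0 g (S : set (bits I)) : 0 < mu (actg g @^-1` S) -> 0 < mt S.
Proof.
move=> h; have [n n1 gn] := gamma_surj g; rewrite mtE.
have u0 i : (1 <= i)%N -> true -> 0 <= (2 ^- i : R)%R%:E * mu (actg (gamma i) @^-1` S).
  by move=> _ _; rewrite mule_ge0 // lee_fin invr_ge0 exprn_ge0.
apply: lt_le_trans (nneseries_lim_ge n.+1 u0).
rewrite big_nat_recr //= gn; apply: (@lt_le_trans _ _ ((2 ^- n : R)%R%:E * mu (actg g @^-1` S))).
  by rewrite mule_gt0 // lte_fin invr_gt0 exprn_gt0.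
rewrite leeDr // big_nat_cond sume_ge0 // => i /andP[/andP[i1 _] _].
by apply: u0.
Qed.

Lemma mt_gt0_ex (S : set (bits I)) : 0 < mt S -> exists g, 0 < mu (actg g @^-1` S).
Proof.
move=> h; apply: contrapT => /forallNP n; move: h; rewrite mtE eseries0 ?ltxx //.
move=> i _ _; have -> : mu (actg (gamma i) @^-1` S) = 0.
  by apply/eqP; rewrite eq_le measure_ge0 andbT leNgt; apply/negP/n.
by rewrite mule0.
Qed.

Lemma mt_mu (S : set (bits I)) : 0 < mu S -> 0 < mt S.
Proof. by move=> h; apply: (@mt_gt0 1%g). Qed.

(** Inside W = [Zset], sets positive for [mt] are positive for [mu], so [mu_chaining] applies, and
    its overlaps are positive for [mt]. *)
Lemma mt_chaining : essentially_chaining (action k) mt k.+1.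
Proof.
exists Zset; split; first exact: measurable_Zset.
- move=> A B mA mB AZ BZ /mt_gt0_ex[g gA] /mt_gt0_ex[h hB].
  have A0 := mu_quasi_invariant mA AZ gA; have B0 := mu_quasi_invariant mB BZ hB.
  have [c [c0 ci ck]] := mu_chaining mA mB (@subsetT _ A) (@subsetT _ B) A0 B0.
  by exists c; split => // [i ik|]; apply: mt_mu; [exact: ci|exact: ck].
- rewrite mtE eseries0 // => n _ _.
  set U := ~` _; suff -> : mu (actg (gamma n) @^-1` U) = 0 by rewrite mule0.
  rewrite -[RHS](measure0 coin); congr (coin _).
  apply/seteqP; split => x //= h; apply: h.
  by exists (gamma n) => //; exists (embed x) => //; exact: Zset_embed.
- rewrite /generates; apply/seteqP; split => // g _ H [HC Hgen].
  have Hl l : H (@FreeGroup _ [:: l] isT).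
    have Hp i : H (@FreeGroup _ [:: (i, false)] isT).
      apply: Hgen; apply: mt_mu; rewrite (_ : _ `&` _ = Zset) ?mu_Zset ?lte01 //.
      apply/seteqP; split => x; first by case.
      (* The inverse of a generator maps [Zset] into itself: it is multiplication by t, a column
         addition or a translation by a unit vector. *)
      move=> Zx; split => //; exists (ltr (i, true) x); last first.
        by have := @ltrK k (i, true) x; rewrite /letterV.
      rewrite /ltr /=; case: ifP => _.
        move=> [z [r c]] /= z0; rewrite /colshift /=; case: ifP => _; rewrite Zx //=.
        by rewrite -(addr0 (0 : int)) ltrD.
      case: ifP => _.
        move=> [z [r c]] /= z0; rewrite /addcol /=.
        by case: ifP => _; rewrite !Zx.
      move=> [z [r c]] /= z0; rewrite /flip /xorf Zx // /dot /=.
      by rewrite !xpair_eqE /= (lt_eqF z0).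
    case: l => i [|//].
    have := group_closedV HC; move=> /(_ (@FreeGroup _ [:: (i, false)] isT)).
    rewrite !inE => /(_ (Hp i)).
    by congr H; exact: val_inj.
  case: g => s; elim: s => [|l s IH] rs.
    have [+ _] := HC; rewrite inE.
    by congr H; exact: val_inj.
  have rs' : reduced s := path_sorted rs.
  have := group_closedM HC => /(_ (@FreeGroup _ [:: l] isT) (FreeGroup rs')).
  rewrite !inE => /(_ (Hl l) (IH rs')).
  congr H; apply: val_inj.
  by rewrite /= (reduce_id rs') -[RHS](reduce_id rs) /= (reduce_id rs').
Qed.

(** Some preimage of W under a group element g is positive for [mu] and contains unchained sets.
    Their images under g lie in W, and conjugating a chain between the images by g gives a forbidden
    chain. *)
Lemma mt_not_chaining : ~ essentially_chaining (action k) mt k.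
Proof.
move=> [W [mW Wk W0 _]].
(* Otherwise the translates of W have a [mu]-null union, while conullness for [mt] makes its
   complement [mu]-null as well. *)
have [g gW] : exists g, 0 < mu (actg g @^-1` W).
  apply: contrapT => /forallNP n.
  have n0 g : mu (actg g @^-1` W) = 0.
    by apply/eqP; rewrite eq_le measure_ge0 andbT leNgt; apply/negP/n.
  pose U := \bigcup_n (actg (gamma n) @` W).
  have UE : \bigcup_g (action k g @` W) = U.
    apply/seteqP; split => [x [g _ gx]|x [i _ ix]]; last by exists (gamma i).
    by have [i _ ig] := gamma_surj g; exists i => //; rewrite ig.
  have mU : measurable U.
    by apply: bigcup_measurable => i _; exact: measurable_image_actg.
  have U0 : mu U = 0.
    apply: measure_negligible => //; apply: negligible_bigcup => i.
    by apply/negligibleP; [exact: measurable_image_actg|rewrite actg_image; exact: n0].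
  have U1 : mu (~` U) = 0.
    apply/eqP; rewrite eq_le measure_ge0 andbT leNgt; apply/negP => h.
    by have := mt_mu h; rewrite -UE W0 ltxx.
  have := probability_setC mu mU; rewrite U1 U0 sube0 => /eqP.
  by rewrite eq_sym onee_eq0.
have [A [B [mA mB AW BW [A0 B0 h]]]] := unchained_sets (measurable_actg g mW) gW.
have sub C : C `<=` actg g @^-1` W -> actg g @` C `<=` W.
  by move=> CW _ [x /CW Cx <-].
have pos C : 0 < mu C -> 0 < mt (actg g @` C).
  move=> C0; apply: (@mt_gt0 g); rewrite (_ : _ @^-1` _ = C) //.
  by rewrite actg_image; apply/seteqP; split => x; rewrite /= actgK.
have [c [c0 ci ck]] := Wk _ _ (measurable_image_actg g mA) (measurable_image_actg g mB)
  (sub _ AW) (sub _ BW) (pos _ A0) (pos _ B0).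
have ne S : 0 < mt S -> S !=set0.
  by move=> S0; apply/set0P; apply/eqP => S00; rewrite S00 measure0 ltxx in S0.
apply: (h (fun i => g^-1 * c i * g)%g).
- by rewrite c0 mulg1 mulVg.
- move=> i ik; have [_ [[_ [a Aa <-] <-] [_ [b Ab <-] e]]] := ne _ (ci i ik).
  exists (actg g^-1%g (actg (c i) (actg g a))); split.
    by exists a => //; rewrite !actgM.
  by exists b => //; rewrite !actgM; congr (actg _ _).
- have [_ [[_ [a Aa <-] <-] [b Bb e]]] := ne _ ck.
  exists b; split => //; exists a => //; rewrite !actgM.
  by rewrite -[RHS](actgK g) e.
Qed.

End Enumeration.

(** Translating by t^(-1) times a unit vector moves [Zset], of full measure, to a null set. *)
Lemma mu_singular : singular (action k) mu.
Proof.
move=> h; have [g hg] := @realized_flip k ((-1)%R, (ord0, L)) (eqxx _).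
have [_ hZ] := h Zset g measurable_Zset.
have : mu Zset = 0.
  apply: hZ; rewrite -[RHS](measure0 coin); congr (coin _).
  apply/seteqP; split => x //= [y Zy]; change (actg g y) with (action k g y).
  move=> e; have := Zset_embed x (i := ((-1)%R, (ord0, L))) isT; rewrite -e.
  by rewrite [action k g y]hg /flip /xorf Zy // /dot eqxx.
by rewrite mu_Zset => /eqP; rewrite onee_eq0.
Qed.

Lemma mu_not_chaining : ~ chaining (action k) mu k.
Proof.
move=> ch; have [|A [B [mA mB _ _ [A0 B0 h]]]] := @unchained_sets setT measurableT.
  by rewrite probability_setT.
have [c [c0 ci ck]] := ch _ _ mA mB (@subsetT _ A) (@subsetT _ B) A0 B0.
have ne S : 0 < mu S -> S !=set0.
  by move=> S0; apply/set0P; apply/eqP => S00; rewrite S00 measure0 ltxx in S0.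
by apply: (h c) => // [i ik|]; apply: ne; [exact: ci|exact: ck].
Qed.

End Nonsingularization.

Theorem proposition6p15 (R : realType) (k : nat) :
  exists (d : measure_display) (X : measurableType d) (mu : probability X R)
         (a : borel_action (free_group 'I_(2 * k + 2)) X),
    [/\ standard_borel R X,
        singular a mu,
        chaining a mu k.+1,
        ~ chaining a mu k &
        forall gamma : nat -> free_group 'I_(2 * k + 2),
          (forall g, exists2 n : nat, (1 <= n)%N & gamma n = g) ->
          essentially_chaining a (nonsingularization a mu gamma) k.+1 /\
          ~ essentially_chaining a (nonsingularization a mu gamma) k].
Proof.
exists _, (bits (int_index k)), (mu R k), (action k); split.
- exact: standard_borel_bits.
- exact: mu_singular.
- exact: mu_chaining.
- exact: mu_not_chaining.
- by move=> gamma hg; split; [exact: mt_chaining|exact: mt_not_chaining].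
Qed.
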